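(* If the problem ''find $u\in\mathbb{R}^m$ such that $x=A^Tu>0$, $x\in(0,1]^n$'' is infeasible, then the time complexity $\mathsf{T_{BP}}$ of the Basic Procedure for the Dual Problem (defined in the context) satisfies $\mathsf{T_{BP}}=O(n^2m/\rho(P_A))$, where $\rho(P_A)$ is the condition number defined in the context. In particular, $\rho(P_A)$ equals $1/\sqrt n$ under well-condition (e.g., $A=(I,-I)$, where $I$ is an identity matrix), and then $\mathsf{T_{BP}}=O(n^{2.5}m)$ if the problem ''find $u\in\mathbb{R}^m$ such that $x=A^Tu>0$, $x\in(0,1]^n$'' is infeasible.
   Context: Here $A\in\mathbb{R}^{m\times n}$ is an integer (or rational) matrix with $\operatorname{rank}(A)=m$. Time is counted in arithmetic operations; the step-size $c\in(0,2)$ is a fixed constant. Vector inequalities are coordinatewise, $\mathbf 1$ is the all-ones vector, $e_k$ the $k$th unit vector, $x^+=\max\{0,x\}$ coordinatewise. $Q_A=A^T(AA^T)^\dagger A$ and $P_A=I-Q_A$, with $(\cdot)^\dagger$ the Moore-Penrose pseudoinverse. For a vector $y$ put $z=P_Ay$ and, for each $j$ with $z_j\ne0$, $\mathrm{bound}'_j(y)=\mathbf 1^T\big[\frac{z}{-z_j}\big]^+$. For a matrix $Q$ with columns $q_i$, the condition number is $\rho(Q)=\max_{x:\|x\|_2=1}\min_i\langle x,\frac{q_i}{\|q_i\|_2}\rangle$. Basic Procedure for the Dual Problem. Input: $P_A$ ($n\times n$). Set $\mathrm{threshold}=\frac{1}{2n^{3/2}}$, $y=\mathbf 1/n$, $z=P_Ay$,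 $v=y-z=Q_Ay$. Repeat the following iteration: (1) if $v>0$, return with case $=2$ (dual feasible); (2) else if $z\ge0$, return with case $=1$ (primal feasible); (3) else let $K=\{k:z_k\le0\}$, $p_K=P_A\sum_{k\in K}e_k$, $\alpha=\langle\frac{p_K}{\|p_K\|_2},z\rangle$. If $\alpha\le-\mathrm{threshold}$, replace $y$ by $y-c\frac{\alpha}{\|p_K\|_2}\sum_{k\in K}e_k$, $z$ by $z-c\frac{\alpha}{\|p_K\|_2}p_K$, and $v$ by $y-z$. Otherwise return with case $=0$ and a nonempty set $J\subseteq\{j:\mathrm{bound}'_j(y)\le\frac12\}$. At the start of the procedure a one-time preprocessing of $P_A$ costing $O(mn^2)$ operations may be performed; it is included in $\mathsf{T_{BP}}$.
   Formalization: For A=(I,-I) the stated value ρ(P_A)=1/√n is false (A=(1,-1) gives ρ=1); the correct value √2/√n is asserted instead, and the O(n^{2.5}m) bound is stated for ρ(P_A)=κ/√n with any constant κ>0, including κ=1. *)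

(* Defs.v *)
From mathcomp Require Import all_boot all_order all_algebra.
From mathcomp Require Import boolp classical_sets reals exp.

Set Implicit Arguments.
Unset Strict Implicit.
Unset Printing Implicit Defensive.

Import Order.TTheory GRing.Theory Num.Theory.
Local Open Scope ring_scope.

Section LinearAlgebra.
Variable R : realType.

Definition dot n (x y : 'cV[R]_n) : R := \sum_i x i 0 * y i 0.

Definition norm2 n (x : 'cV[R]_n) : R := Num.sqrt (dot x x).

Definition is_mp_inverse m n (M : 'M[R]_(m, n)) (X : 'M[R]_(n, m)) : Prop :=
  [/\ M *m X *m M = M, X *m M *m X = X,
      (M *m X)^T = M *m X & (X *m M)^T = X *m M].

(* [pinvmx] of MathComp is a generalized inverse, but in general not the
   Moore-Penrose one. *)
Definition mp_inverse m n (M : 'M[R]_(m, n)) : 'M[R]_(n, m) :=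
  xget 0 [set X | is_mp_inverse M X]%classic.

Definition projQ m n (A : 'M[R]_(m, n)) : 'M[R]_n :=
  A^T *m mp_inverse (A *m A^T) *m A.

Definition projP m n (A : 'M[R]_(m, n)) : 'M[R]_n := 1%:M - projQ A.

(* The infimum ranges over the finitely many columns (it is a minimum for
   0 < n) and the supremum over a compact sphere (it is a maximum).  A zero
   column contributes the value 0, since division by 0 gives 0. *)
Definition cond_number n (Q : 'M[R]_n) : R :=
  sup [set inf [set dot x ((norm2 (col i Q))^-1 *: col i Q) | i in [set: 'I_n]]
      | x in [set x : 'cV[R]_n | norm2 x = 1]]%classic.

Definition dual_feasible m n (A : 'M[R]_(m, n)) : Prop :=
  exists u : 'cV[R]_m, forall i, 0 < (A^T *m u) i 0 <= 1.

End LinearAlgebra.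

Section BasicProcedure.
Variables (R : realType) (n : nat) (P : 'M[R]_n) (c : R).

Definition threshold : R := (2 * n%:R `^ (3 / 2))^-1.

Record bp_state := BPState { bp_y : 'cV[R]_n; bp_z : 'cV[R]_n; bp_v : 'cV[R]_n }.

Definition bp_init : bp_state :=
  let y := const_mx n%:R^-1 in
  let z := P *m y in
  BPState y z (y - z).

Definition bp_e (s : bp_state) : 'cV[R]_n :=
  \sum_(k in [set k : 'I_n | bp_z s k 0 <= 0]) delta_mx k 0.

Definition bp_p (s : bp_state) : 'cV[R]_n := P *m bp_e s.

Definition bp_alpha (s : bp_state) : R :=
  dot ((norm2 (bp_p s))^-1 *: bp_p s) (bp_z s).

Definition bp_step (s : bp_state) : bp_state :=
  let a := c * (bp_alpha s / norm2 (bp_p s)) in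
  let y := bp_y s - a *: bp_e s in
  let z := bp_z s - a *: bp_p s in
  BPState y z (y - z).

Definition bp_iterate (t : nat) : bp_state := iter t bp_step bp_init.

(* [Some k]: return with case = k; [None]: perform a further update. *)
Definition bp_verdict (s : bp_state) : option nat :=
  if [forall i, 0 < bp_v s i 0] then Some 2%N
  else if [forall i, 0 <= bp_z s i 0] then Some 1%N
  else if bp_alpha s <= - threshold then None
  else Some 0%N.

Definition bound' (y : 'cV[R]_n) (j : 'I_n) : R :=
  let z := P *m y in \sum_i Num.max 0 (z i 0 / - z j 0).

(* The procedure performs exactly [N] updates and then returns [case] and,
   for case 0, the index set [J]. *)
Definition bp_run (N case : nat) (J : {set 'I_n}) : Prop :=
  [/\ forall t, (t < N)%N -> bp_verdict (bp_iterate t) = None,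
      bp_verdict (bp_iterate N) = Some case
    & case = 0%N ->
      J != finset.set0 /\
      forall j, j \in J ->
        (P *m bp_y (bp_iterate N)) j 0 != 0 /\
        bound' (bp_y (bp_iterate N)) j <= 1 / 2].

End BasicProcedure.

(* A real random-access machine.  Programs are uniform: a single program has
   to serve all dimensions.  Index registers hold natural numbers and can only
   be incremented and compared; real numbers live in two-dimensional arrays
   and can only be combined by arithmetic, square roots and comparisons.
   Every arithmetic operation, and also every memory access, index operation,
   comparison and control step, costs one time unit. *)

Inductive nexp : Type :=
| NConst of nat
| NReg of nat
| NSucc of nexp.

Inductive rexp : Type :=
| RNat of nexp
| RArr of nat & nexp & nexp
| RAdd of rexp & rexp
| RSub of rexp & rexp
| RMul of rexp & rexp
| RDiv of rexp & rexp
| RSqrt of rexp.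

Inductive bexp : Type :=
| BNlt of nexp & nexp
| BRle of rexp & rexp
| BNot of bexp
| BAnd of bexp & bexp.

Inductive cmd : Type :=
| Skip
| NAssign of nat & nexp
| RAssign of nat & nexp & nexp & rexp
| Seq of cmd & cmd
| If of bexp & cmd & cmd
| While of bexp & cmd.

Fixpoint ncost (e : nexp) : nat :=
  match e with
  | NConst _ | NReg _ => 1
  | NSucc e1 => (ncost e1).+1
  end.

Fixpoint rcost (e : rexp) : nat :=
  match e with
  | RNat e1 => (ncost e1).+1
  | RArr _ e1 e2 => (ncost e1 + ncost e2).+1
  | RAdd e1 e2 | RSub e1 e2 | RMul e1 e2 | RDiv e1 e2 =>
      (rcost e1 + rcost e2).+1
  | RSqrt e1 => (rcost e1).+1
  end.

Fixpoint bcost (b : bexp) : nat :=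
  match b with
  | BNlt e1 e2 => (ncost e1 + ncost e2).+1
  | BRle e1 e2 => (rcost e1 + rcost e2).+1
  | BNot b1 => (bcost b1).+1
  | BAnd b1 b2 => (bcost b1 + bcost b2).+1
  end.

Section Semantics.
Variable R : realType.

Record store := Store { reg : nat -> nat; arr : nat -> nat -> nat -> R }.

Definition set_reg (s : store) (x k : nat) : store :=
  Store (fun x' => if x' == x then k else reg s x') (arr s).

Definition set_arr (s : store) (a i j : nat) (r : R) : store :=
  Store (reg s) (fun a' i' j' =>
    if [&& a' == a, i' == i & j' == j] then r else arr s a' i' j').

Fixpoint neval (s : store) (e : nexp) : nat :=
  match e with
  | NConst k => k
  | NReg x => reg s x
  | NSucc e1 => (neval s e1).+1
  end.

Fixpoint reval (s : store) (e : rexp) : R :=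
  match e with
  | RNat e1 => (neval s e1)%:R
  | RArr a e1 e2 => arr s a (neval s e1) (neval s e2)
  | RAdd e1 e2 => reval s e1 + reval s e2
  | RSub e1 e2 => reval s e1 - reval s e2
  | RMul e1 e2 => reval s e1 * reval s e2
  | RDiv e1 e2 => reval s e1 / reval s e2
  | RSqrt e1 => Num.sqrt (reval s e1)
  end.

Fixpoint beval (s : store) (b : bexp) : bool :=
  match b with
  | BNlt e1 e2 => (neval s e1 < neval s e2)%N
  | BRle e1 e2 => reval s e1 <= reval s e2
  | BNot b1 => ~~ beval s b1
  | BAnd b1 b2 => beval s b1 && beval s b2
  end.

(* [exec p s s' T]: started in [s], program [p] halts in [s'] after [T] time
   units. *)
Inductive exec : cmd -> store -> store -> nat -> Prop :=
| exec_skip s : exec Skip s s 1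
| exec_nassign s x e :
    exec (NAssign x e) s (set_reg s x (neval s e)) (ncost e).+1
| exec_rassign s a e1 e2 e :
    exec (RAssign a e1 e2 e) s
         (set_arr s a (neval s e1) (neval s e2) (reval s e))
         (ncost e1 + ncost e2 + rcost e).+1
| exec_seq p q s s1 s2 T1 T2 :
    exec p s s1 T1 -> exec q s1 s2 T2 -> exec (Seq p q) s s2 (T1 + T2)
| exec_if_true b p q s s1 T :
    beval s b -> exec p s s1 T -> exec (If b p q) s s1 (bcost b + T).+1
| exec_if_false b p q s s1 T :
    ~~ beval s b -> exec q s s1 T -> exec (If b p q) s s1 (bcost b + T).+1
| exec_while_true b p s s1 s2 T1 T2 :
    beval s b -> exec p s s1 T1 -> exec (While b p) s1 s2 T2 ->
    exec (While b p) s s2 (bcost b + T1 + T2).+1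
| exec_while_false b p s :
    ~~ beval s b -> exec (While b p) s s (bcost b).+1.

End Semantics.

Definition reg_n : nat := 0.
Definition reg_N : nat := 1.
Definition reg_case : nat := 2.
Definition arr_P : nat := 0.
Definition arr_c : nat := 1.
Definition arr_Y : nat := 2.
Definition arr_Z : nat := 3.
Definition arr_V : nat := 4.
Definition arr_J : nat := 5.

Section Implementation.
Variable R : realType.

Definition bp_input n (P : 'M[R]_n) (c : R) : store R :=
  Store
    (fun x => if x == reg_n then n else 0%N)
    (fun a i j =>
       if a == arr_P then
         if insub i is Some i' then
           if insub j is Some j' then P i' j' else 0
         else 0
       else if [&& a == arr_c, i == 0%N & j == 0%N] then c
       else 0).

(* The final store must contain the whole run, not only the returned value:
   row t of the arrays Y, Z, V is the t-th iterate. *)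
Definition bp_output n (P : 'M[R]_n) (c : R) (s : store R) : Prop :=
  bp_run P c (reg s reg_N) (reg s reg_case)
         [set j : 'I_n | arr s arr_J 0 j != 0] /\
  forall (t : nat) (i : 'I_n), (t <= reg s reg_N)%N ->
    [/\ arr s arr_Y t i = bp_y (bp_iterate P c t) i 0,
        arr s arr_Z t i = bp_z (bp_iterate P c t) i 0
      & arr s arr_V t i = bp_v (bp_iterate P c t) i 0].

Definition real_of_rat m n (A : 'M[rat]_(m, n)) : 'M[R]_(m, n) :=
  map_mx ratr A.

Definition implements_bp (prog : cmd) : Prop :=
  forall (c : R) (m n : nat) (A : 'M[rat]_(m, n)),
    0 < c < 2 -> (0 < m)%N -> \rank A = m ->
    let P := projP (real_of_rat A) in
    exists (s : store R) (T : nat),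
      exec prog (bp_input P c) s T /\ bp_output P c s.

(* The execution relation is deterministic, so at most one [T] qualifies. *)
Definition bp_time (prog : cmd) (c : R) m n (A : 'M[rat]_(m, n)) (T : nat) :
    Prop :=
  exists s : store R, exec prog (bp_input (projP (real_of_rat A)) c) s T.

End Implementation.

(* Main.v *)
Require Import Defs.
From mathcomp Require Import all_boot all_order all_algebra.
From mathcomp Require Import boolp classical_sets reals exp.
From mathcomp Require Import zify ring lra.

Set Implicit Arguments.
Unset Strict Implicit.
Unset Printing Implicit Defensive.

Import Order.TTheory GRing.Theory Num.Theory.
Local Open Scope ring_scope.

(* Q = I - P is an orthogonal projection of trace m.  Cholesky elimination on
   its diagonal removes one unit of trace at each nonzero pivot, so it stops
   after m pivots of cost O(n^2) and writes Q as a sum of m rank one matrices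
   b b^T.  From then on a product P x costs O(mn), and so does one iteration.

   Let x be a unit vector with <x, p_i> >= w |p_i| for all columns p_i of P,
   where w = rho(P)/2.  As p_K is a sum of columns, <x, p_K> >= w |p_K| by the
   triangle inequality, so each update increases <x, z> by at least
   c w / (2 n^(3/2)).  Since |z| never exceeds its initial value, which is at
   most 1/sqrt n, there are at most 4n / (c rho(P)) updates.  Without x,
   termination follows because each update decreases |z|^2 by at least
   c (2 - c) / (4 n^3). *)

(** * Running programs *)

(** The machine receives [n] and [P] but neither [m] nor [A], and multiplying by [P] directly would
    cost n^2 per iteration. The factor m has to be found inside [P]: it is the trace of Q, and the
    elimination discovers it as the number of nonzero pivots. A visit to a zero diagonal entry costs
    O(1), so the pass over the whole diagonal stays within O(mn^2).

    The supremum in rho(P) is never shown to be attained; taking half of rho leaves room for a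
    vector x at the price of a factor 2. Preprocessing costs n^2 m and the iterations cost (4n / (c
    rho)) nm, up to a constant. Both fit under a multiple of n^2 m / rho because rho <= 1 by
    Cauchy-Schwarz, whence the factor 1 + 4/c in the final constant. The halting argument without x
    is there because the program must be correct on every A of full row rank, also where rho(P) is
    not positive. *)

Section ProgramLogic.
Variable R : realType.
Implicit Types (p q : cmd) (s : store R).

(** [bp_time] speaks of an arbitrary execution; determinism transfers to it the bound proved for the
    execution constructed below. *)
Lemma exec_det p s s1 T1 : exec p s s1 T1 ->
  forall s2 T2, exec p s s2 T2 -> s1 = s2 /\ T1 = T2.
Proof.
elim=> {p s s1 T1}.
- by move=> s s2 T2 H; inversion H.
- by move=> s x e s2 T2 H; inversion H.
- by move=> s a e1 e2 e s2 T2 H; inversion H.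
- move=> p q s s1 s2 T1 T2 _ IHp _ IHq s3 T3 H.
  inversion H as [| | |? ? ? s4 ? T4 T5 hp hq| | | |]; subst.
  have [? ?] := IHp _ _ hp; subst.
  by have [-> ->] := IHq _ _ hq.
- move=> b p q s s1 T hb _ IH s2 T2 H.
  inversion H as [| | | |? ? ? ? ? T3 hb' hp|? ? ? ? ? T3 hb' hq| |]; subst.
    by have [-> ->] := IH _ _ hp.
  by rewrite hb in hb'.
- move=> b p q s s1 T hb _ IH s2 T2 H.
  inversion H as [| | | |? ? ? ? ? T3 hb' hp|? ? ? ? ? T3 hb' hq| |]; subst.
    by rewrite hb' in hb.
  by have [-> ->] := IH _ _ hq.
- move=> b p s s1 s2 T1 T2 hb _ IH1 _ IH2 s3 T3 H.
  inversion H as [| | | | | |? ? ? s4 ? T4 T5 hb' hp hw|? ? ? hb']; subst.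
    have [? ?] := IH1 _ _ hp; subst.
    by have [-> ->] := IH2 _ _ hw.
  by rewrite hb in hb'.
- move=> b p s hb s2 T2 H.
  inversion H as [| | | | | |? ? ? s4 ? T4 T5 hb' hp hw|? ? ? hb']; subst => //.
  by rewrite hb' in hb.
Qed.

Fixpoint mod_regs p : seq nat :=
  match p with
  | Skip | RAssign _ _ _ _ => [::]
  | NAssign x _ => [:: x]
  | Seq p q | If _ p q => mod_regs p ++ mod_regs q
  | While _ p => mod_regs p
  end.

Fixpoint mod_arrs p : seq nat :=
  match p with
  | Skip | NAssign _ _ => [::]
  | RAssign a _ _ _ => [:: a]
  | Seq p q | If _ p q => mod_arrs p ++ mod_arrs q
  | While _ p => mod_arrs p
  end.

(** A syntactic frame: an array counts as changed as a whole once any of its cells is assigned, so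
    side conditions on [mod_regs] and [mod_arrs] are settled by computation. *)
Definition framed p s s' : Prop :=
  (forall x, x \notin mod_regs p -> reg s' x = reg s x) /\
  (forall a i j, a \notin mod_arrs p -> arr s' a i j = arr s a i j).

Lemma framed_trans p s s1 s2 : framed p s s1 -> framed p s1 s2 -> framed p s s2.
Proof.
move=> [h1 h2] [k1 k2]; split=> [x hx|a i j ha].
  by rewrite k1 // h1.
by rewrite k2 // h2.
Qed.

Lemma framed_sub p q s s' :
  {subset mod_regs q <= mod_regs p} -> {subset mod_arrs q <= mod_arrs p} ->
  framed q s s' -> framed p s s'.
Proof.
move=> hr ha [h1 h2]; split=> [x hx|a i j hx].
  by apply: h1; apply: contra hx; apply: hr.
by apply: h2; apply: contra hx; apply: ha.
Qed.

Lemma exec_framed p s s' T : exec p s s' T -> framed p s s'.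
Proof.
elim=> {p s s' T} //.
- by move=> s x e; split=> // y; rewrite /= inE; case: eqP.
- move=> s a e1 e2 e; split=> // b i j; rewrite /= inE => /negPf hb.
  by rewrite hb.
- move=> p q s s1 s2 T1 T2 _ h1 _ h2.
  apply: (@framed_trans _ _ s1).
    by apply: framed_sub h1 => x; rewrite /= mem_cat => ->.
  by apply: framed_sub h2 => x; rewrite /= mem_cat orbC => ->.
- by move=> b p q s s1 T _ _ h; apply: framed_sub h => x; rewrite /= mem_cat => ->.
- by move=> b p q s s1 T _ _ h; apply: framed_sub h => x;
    rewrite /= mem_cat orbC => ->.
- by move=> b p s s1 s2 T1 T2 _ _ h1 _ h2; exact: framed_trans h1 h2.
Qed.

(** Total correctness with a clock: halting is part of the claim, and the postcondition also
    receives the running time. *)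
Definition run p s (Q : store R -> nat -> Prop) : Prop :=
  exists s' T, exec p s s' T /\ Q s' T.

(** The frame is handed to the new postcondition, so the specifications below need not list what
    stays unchanged. *)
Lemma run_conseq p s (Q Q' : store R -> nat -> Prop) :
  run p s Q -> (forall s' T, framed p s s' -> Q s' T -> Q' s' T) -> run p s Q'.
Proof.
move=> [s' [T [h hQ]]] H; exists s', T; split=> //; apply: H => //.
exact: exec_framed h.
Qed.

Lemma run_skip s (Q : store R -> nat -> Prop) : Q s 1%N -> run Skip s Q.
Proof. by move=> h; exists s, 1%N; split=> //; constructor. Qed.

Lemma run_nassign s x e (Q : store R -> nat -> Prop) :
  Q (set_reg s x (neval s e)) (ncost e).+1 -> run (NAssign x e) s Q.
Proof. by move=> h; do 2 eexists; split; [constructor | exact: h]. Qed.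

Lemma run_rassign s a e1 e2 e (Q : store R -> nat -> Prop) :
  Q (set_arr s a (neval s e1) (neval s e2) (reval s e))
    (ncost e1 + ncost e2 + rcost e).+1 -> run (RAssign a e1 e2 e) s Q.
Proof. by move=> h; do 2 eexists; split; [constructor | exact: h]. Qed.

Lemma run_seq p q s (Q : store R -> nat -> Prop) :
  run p s (fun s1 T1 => run q s1 (fun s2 T2 => Q s2 (T1 + T2)%N)) ->
  run (Seq p q) s Q.
Proof.
move=> [s1 [T1 [h1 [s2 [T2 [h2 h]]]]]]; exists s2, (T1 + T2)%N.
by split=> //; apply: exec_seq h1 h2.
Qed.

Lemma run_if b p q s (Q : store R -> nat -> Prop) :
  run (if beval s b then p else q) s (fun s' T => Q s' (bcost b + T).+1) ->
  run (If b p q) s Q.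
Proof.
case: (boolP (beval s b)) => hb [s' [T [h hQ]]]; exists s', (bcost b + T).+1;
  split=> //.
  exact: exec_if_true.
exact: exec_if_false.
Qed.

Definition for_loop (x b : nat) body : cmd :=
  Seq (NAssign x (NConst 0))
      (While (BNlt (NReg x) (NReg b)) (Seq body (NAssign x (NSucc (NReg x))))).

(* The first component of [I] is the loop index, the last one the time spent
   so far; entering and leaving the loop costs 6, each round costs 7 on top of
   its body. *)
Lemma run_for_time (x b : nat) body s (I : nat -> store R -> nat -> Prop) :
  x != b -> x \notin mod_regs body -> b \notin mod_regs body ->
  I 0%N (set_reg s x 0) 6%N ->
  (forall k s1 T, (k < reg s b)%N -> framed (for_loop x b body) s s1 ->
     reg s1 x = k -> I k s1 T ->
     run body s1 (fun s2 T2 => I k.+1 (set_reg s2 x k.+1) (T + T2 + 7)%N)) ->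
  run (for_loop x b body) s (fun s' T => I (reg s b) s' T).
Proof.
move=> xb xbody bbody I0 Istep.
have bF : b \notin mod_regs (for_loop x b body).
  by rewrite /= !(mem_cat, inE) (negPf bbody) eq_sym (negPf xb).
pose loop := While (BNlt (NReg x) (NReg b)) (Seq body (NAssign x (NSucc (NReg x)))).
(* Induction on the number [d] of remaining rounds. The 6 books in advance the initial assignment
   (2) and the final failing test (4); the time [T'] of the loop already contains the latter, hence
   the 2 in the conclusion. *)
suff H d : forall k s1 T, (k + d = reg s b)%N -> framed (for_loop x b body) s s1 ->
    reg s1 x = k -> I k s1 (T + 6)%N ->
    run loop s1 (fun s' T' => I (reg s b) s' (T + T' + 2)%N).
  apply/run_seq/run_nassign.
  have F0 : framed (for_loop x b body) s (set_reg s x 0).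
    split=> // y; rewrite /= inE negb_or => /andP[/negPf -> _] //.
  have /= := H (reg s b) 0%N (set_reg s x 0) 0%N (add0n _) F0.
  rewrite eqxx add0n => /(_ erefl I0) h.
  by apply: run_conseq h _ => s' T _; rewrite add0n addnC.
elim: d => [|d IH] k s1 T kd F1 xk hI.
  exists s1, 4%N; split; last first.
    by rewrite -kd addn0 -addnA.
  by apply: exec_while_false; rewrite /= xk (F1.1 _ bF) -kd addn0 ltnn.
have kb : (k < reg s b)%N by rewrite -kd addnS ltnS leq_addr.
have [s2 [T2 [h2 hI2]]] := Istep _ _ _ kb F1 xk hI.
have x2 : reg s2 x = k by rewrite (exec_framed h2).1.
have h3 : exec (Seq body (NAssign x (NSucc (NReg x)))) s1 (set_reg s2 x k.+1)
            (T2 + 3)%N.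
  apply: exec_seq h2 _; rewrite -x2; exact: exec_nassign.
have F3 : framed (for_loop x b body) s (set_reg s2 x k.+1).
  apply: framed_trans F1 _.
  by apply: framed_sub (exec_framed h3) => y; rewrite /= ?inE => ->; rewrite ?orbT.
have := IH k.+1 (set_reg s2 x k.+1) (T + T2 + 7)%N _ F3.
rewrite /= eqxx addSnnS => /(_ kd erefl).
rewrite (_ : T + T2 + 7 + 6 = T + 6 + T2 + 7)%N; last by lia.
move=> /(_ hI2) [s4 [T4 [h4 hI4]]].
exists s4, (bcost (BNlt (NReg x) (NReg b)) + (T2 + 3) + T4).+1; split.
  apply: exec_while_true h3 h4 => /=.
  by rewrite xk (F1.1 _ bF).
rewrite (_ : T + _ + 2 = T + T2 + 7 + T4 + 2)%N //.
by rewrite /=; lia.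
Qed.

Lemma run_for (x b : nat) body s (I : nat -> store R -> Prop) K :
  x != b -> x \notin mod_regs body -> b \notin mod_regs body ->
  I 0%N (set_reg s x 0) ->
  (forall k s1, (k < reg s b)%N -> framed (for_loop x b body) s s1 ->
     reg s1 x = k -> I k s1 ->
     run body s1 (fun s2 T => I k.+1 (set_reg s2 x k.+1) /\ (T <= K)%N)) ->
  run (for_loop x b body) s
    (fun s' T => I (reg s b) s' /\ (T <= reg s b * (K + 7) + 6)%N).
Proof.
move=> xb xbody bbody I0 Istep.
apply: (run_for_time (I := fun k s T => I k s /\ (T <= k * (K + 7) + 6)%N)) => //.
move=> k s1 T kb F1 xk [hI hT].
apply: run_conseq (Istep _ _ kb F1 xk hI) _ => s2 T2 _ [hI2 hT2]; split=> //.
by rewrite mulSn; lia.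
Qed.

(** The row is overwritten from left to right. The body knows that the entries from [k] on still
    have their old values, so updates in place are covered. *)
Lemma run_map (x b a i : nat) (f : nat -> R) body s K :
  x != b -> x \notin mod_regs body -> b \notin mod_regs body ->
  (forall k s1, (k < reg s b)%N -> framed (for_loop x b body) s s1 ->
     reg s1 x = k ->
     (forall i' j', arr s1 a i' j' =
        if (i' == i) && (j' < k)%N then f j' else arr s a i' j') ->
     run body s1 (fun s2 T => s2 = set_arr s1 a i k (f k) /\ (T <= K)%N)) ->
  run (for_loop x b body) s (fun s' T =>
    (forall i' j', arr s' a i' j' =
       if (i' == i) && (j' < reg s b)%N then f j' else arr s a i' j') /\
    (T <= reg s b * (K + 7) + 6)%N).
Proof.
move=> xb xbody bbody H.
apply: (run_for (I := fun k s' => forall i' j', arr s' a i' j' =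
       if (i' == i) && (j' < k)%N then f j' else arr s a i' j')) => //.
  by move=> i' j'; rewrite ltn0 andbF.
move=> k s1 kb F1 xk hI; apply: run_conseq (H _ _ kb F1 xk hI) _.
move=> s2 T _ [-> hT]; split=> // i' j' /=; rewrite eqxx hI ltnS [(j' <= k)%N]leq_eqVlt.
by case: (i' == i) => //=; case: eqP => [->|].
Qed.

(** Of the array being written, the body only knows that its own cell is still untouched; this
    suffices for entrywise updates in place. *)
Lemma run_map2 (x y b a : nat) (f : nat -> nat -> R) body s K :
  x != b -> y != b -> x != y ->
  x \notin mod_regs body -> y \notin mod_regs body -> b \notin mod_regs body ->
  (forall i j s1, (i < reg s b)%N -> (j < reg s b)%N ->
     framed (for_loop x b (for_loop y b body)) s s1 ->
     reg s1 x = i -> reg s1 y = j ->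
     arr s1 a i j = arr s a i j ->
     run body s1 (fun s2 T => s2 = set_arr s1 a i j (f i j) /\ (T <= K)%N)) ->
  run (for_loop x b (for_loop y b body)) s (fun s' T =>
    (forall i j, (i < reg s b)%N -> (j < reg s b)%N -> arr s' a i j = f i j) /\
    (T <= reg s b * (reg s b * (K + 7) + 6 + 7) + 6)%N).
Proof.
move=> xb yb xy xbody ybody bbody H.
(* The array after [k] complete rows. *)
pose g k i j := if (i < k)%N && (j < reg s b)%N then f i j else arr s a i j.
have xin : x \notin mod_regs (for_loop y b body).
  by rewrite /= !(mem_cat, inE) !negb_or xy xbody.
have bin : b \notin mod_regs (for_loop y b body).
  by rewrite /= !(mem_cat, inE) !negb_or eq_sym yb bbody.
have bF : b \notin mod_regs (for_loop x b (for_loop y b body)).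
  by rewrite /= !(mem_cat, inE) !negb_or -!(eq_sym _ b) xb yb bbody.
refine (@run_conseq _ _ (fun s' T => (forall i j, arr s' a i j = g (reg s b) i j) /\
    (T <= reg s b * (reg s b * (K + 7) + 6 + 7) + 6)%N) _ _ _); last first.
  by move=> s' T _ [h hT]; split=> // i j hi hj; rewrite h /g hi hj.
apply: (run_for (I := fun k s' => forall i j, arr s' a i j = g k i j)) => //.
move=> i s1 ib F1 xi hI.
have b1 : reg s1 b = reg s b by rewrite F1.1.
rewrite -b1; apply: run_conseq.
  apply: (@run_map y b a i (f i) body s1 K) => // j s2; rewrite b1 => jb F2 yj hI2.
  apply: H => //.
  - apply: framed_trans F1 _; apply: framed_sub F2 => z // hz.
      by rewrite inE mem_cat hz orbT.
    by rewrite /= cats0.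
  - by rewrite F2.1.
  - by rewrite hI2 ltnn andbF hI /g ltnn.
move=> s2 T F2 [h2 hT]; split=> // i' j' /=; rewrite h2 hI b1 /g ltnS.
rewrite [(i' <= i)%N]leq_eqVlt.
have [->|//] := eqVneq i' i.
by rewrite ltnn /=.
Qed.

Lemma run_sum (x b a i j : nat) (f : nat -> R) body s K :
  x != b -> x \notin mod_regs body -> b \notin mod_regs body ->
  (forall k s1, (k < reg s b)%N -> framed (for_loop x b body) s s1 ->
     reg s1 x = k ->
     (forall i' j' : nat, (i' != i) || (j' != j) -> arr s1 a i' j' = arr s a i' j') ->
     run body s1 (fun s2 T =>
       s2 = set_arr s1 a i j (arr s1 a i j + f k) /\ (T <= K)%N)) ->
  run (for_loop x b body) s (fun s' T =>
    [/\ arr s' a i j = arr s a i j + \sum_(k < reg s b) f k,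
        forall i' j' : nat, (i' != i) || (j' != j) -> arr s' a i' j' = arr s a i' j'
      & (T <= reg s b * (K + 7) + 6)%N]).
Proof.
move=> xb xbody bbody H.
apply: (@run_conseq _ _ (fun s' T =>
   (arr s' a i j = arr s a i j + \sum_(k < reg s b) f k /\
    forall i' j' : nat, (i' != i) || (j' != j) -> arr s' a i' j' = arr s a i' j') /\
   (T <= reg s b * (K + 7) + 6)%N)); last by move=> s' T _ [[]].
apply: (run_for (I := fun k s' => arr s' a i j = arr s a i j + \sum_(l < k) f l /\
    forall i' j' : nat, (i' != i) || (j' != j) -> arr s' a i' j' = arr s a i' j')) => //.
  by rewrite big_ord0 addr0.
move=> k s1 kb F1 xk [hI hI']; apply: run_conseq (H _ _ kb F1 xk hI') _.
move=> s2 T _ [-> hT]; split=> //=; split.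
  by rewrite !eqxx hI big_ord_recr addrA.
move=> i' j' hij; rewrite eqxx /=; have := hij.
by rewrite -negb_and => /negPf ->; rewrite hI'.
Qed.

Lemma run_flag (x b y : nat) (f : nat -> bool) e s :
  x != b -> x != y -> y != b -> reg s y = 0%N ->
  (forall k s1, (k < reg s b)%N ->
     framed (for_loop x b (If e (NAssign y (NConst 1)) Skip)) s s1 ->
     reg s1 x = k -> beval s1 e = f k) ->
  run (for_loop x b (If e (NAssign y (NConst 1)) Skip)) s (fun s' T =>
    (reg s' y == 0%N) = [forall k : 'I_(reg s b), ~~ f k] /\
    (T <= reg s b * ((bcost e).+3 + 7) + 6)%N).
Proof.
move=> xb xy yb y0 H.
apply: (run_for (I := fun k s' => (reg s' y == 0%N) = [forall l : 'I_k, ~~ f l])).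
- by [].
- by rewrite /= inE.
- by rewrite /= inE eq_sym.
- by rewrite /= [y == x]eq_sym (negPf xy) y0 eqxx; symmetry; apply/forallP => -[].
move=> k s1 kb F1 xk hI; apply: run_if; rewrite (H _ _ kb F1 xk).
have split_forall : [forall l : 'I_k.+1, ~~ f l] = [forall l : 'I_k, ~~ f l] && ~~ f k.
  apply/forallP/andP => [h|[/forallP h hk] l].
    split; last exact: (h ord_max).
    by apply/forallP => l; have := h (widen_ord (leqnSn k) l).
  have := ltn_ord l; rewrite ltnS leq_eqVlt => /orP[/eqP -> //|lk].
  exact: (h (Ordinal lk)).
have yx : (y == x) = false by rewrite eq_sym; apply: negPf.
case fk: (f k); [apply: run_nassign|apply: run_skip]; rewrite /= yx ?eqxx.
  by rewrite split_forall fk andbF; split=> //; lia.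
by rewrite split_forall fk andbT hI; split=> //; lia.
Qed.

End ProgramLogic.

(** * Orthogonal projections *)

Lemma le_of_eq (R : numDomainType) (x y : R) : x = y -> x <= y.
Proof. by move=> ->. Qed.

(** * Inner product, Cauchy-Schwarz and the triangle inequality *)

Section Dot.
Variables (R : realType) (n : nat).
Implicit Types (x y z : 'cV[R]_n).

Lemma dotE x y : dot x y = (x^T *m y) 0 0.
Proof. by rewrite mxE; apply: eq_bigr => i _; rewrite mxE. Qed.

Lemma dotC x y : dot x y = dot y x.
Proof. by apply: eq_bigr => i _; rewrite mulrC. Qed.

Lemma dotDr x y z : dot x (y + z) = dot x y + dot x z.
Proof. by rewrite !dotE mulmxDr mxE. Qed.

Lemma dotZr a x y : dot x (a *: y) = a * dot x y.
Proof. by rewrite !dotE -scalemxAr mxE. Qed.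

Lemma dotBr x y z : dot x (y - z) = dot x y - dot x z.
Proof. by rewrite dotDr -scaleN1r dotZr mulN1r. Qed.

Lemma dotDl x y z : dot (x + y) z = dot x z + dot y z.
Proof. by rewrite dotC dotDr !(dotC z). Qed.

Lemma dotZl a x y : dot (a *: x) y = a * dot x y.
Proof. by rewrite dotC dotZr dotC. Qed.

Lemma dotBl x y z : dot (x - y) z = dot x z - dot y z.
Proof. by rewrite dotC dotBr !(dotC z). Qed.

Lemma dot0l x : dot 0 x = 0.
Proof. by rewrite /dot big1 // => i _; rewrite mxE mul0r. Qed.

Lemma dot_sumr (I : finType) (F : I -> 'cV[R]_n) (Pr : pred I) x :
  dot x (\sum_(i | Pr i) F i) = \sum_(i | Pr i) dot x (F i).
Proof.
rewrite dotE mulmx_sumr summxE; apply: eq_bigr => i _; by rewrite dotE.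
Qed.

Lemma dot_mulmxl (M : 'M[R]_n) x y : dot (M *m x) y = dot x (M^T *m y).
Proof. by rewrite !dotE trmx_mul mulmxA. Qed.

Lemma dot_delta x i : dot x (delta_mx i 0) = x i 0.
Proof.
rewrite /dot (bigD1 i) //= mxE !eqxx mulr1 big1 ?addr0 // => j ji.
by rewrite mxE (negPf ji) mulr0.
Qed.

Lemma dot_ge0 x : 0 <= dot x x.
Proof. by apply: sumr_ge0 => i _; rewrite -expr2 sqr_ge0. Qed.

Lemma dot_eq0 x : dot x x = 0 -> x = 0.
Proof.
move=> h; apply/colP => i; rewrite mxE.
have /psumr_eq0P h2 : forall j : 'I_n, true -> 0 <= x j 0 * x j 0.
  by move=> j _; rewrite -expr2 sqr_ge0.
by have /eqP := h2 h i isT; rewrite mulf_eq0 orbb => /eqP.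
Qed.

Lemma dot_sqr_le x y : dot x y ^+ 2 <= dot x x * dot y y.
Proof.
have [/dot_eq0 ->|y0] := eqVneq (dot y y) 0.
  by rewrite dotC !dot0l mulr0 expr0n.
have yp : 0 < dot y y by rewrite lt_neqAle eq_sym y0 dot_ge0.
(* The squared length of this vector is <y,y> (<x,x><y,y> - <x,y>^2). *)
have := dot_ge0 (dot y y *: x - dot x y *: y).
rewrite !(dotBl, dotBr, dotZl, dotZr) (dotC y x) => h.
have : 0 <= dot y y * (dot x x * dot y y - dot x y ^+ 2).
  by apply: le_trans h _; apply: le_of_eq; ring.
by rewrite pmulr_rge0 // subr_ge0.
Qed.

Lemma norm2_ge0 x : 0 <= norm2 x.
Proof. exact: sqrtr_ge0. Qed.

Lemma sqr_norm2 x : norm2 x ^+ 2 = dot x x.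
Proof. by rewrite sqr_sqrtr // dot_ge0. Qed.

Lemma norm2_eq0 x : norm2 x = 0 -> x = 0.
Proof. by move=> h; apply: dot_eq0; rewrite -sqr_norm2 h expr0n. Qed.

Lemma dot_le_norm2 x y : dot x y <= norm2 x * norm2 y.
Proof.
apply: le_trans (ler_norm _) _; rewrite -sqrtr_sqr.
by rewrite -sqrtrM ?dot_ge0 // ler_wsqrtr // dot_sqr_le.
Qed.

Lemma norm2D_le x y : norm2 (x + y) <= norm2 x + norm2 y.
Proof.
rewrite -(@ler_pXn2r _ 2) // ?nnegrE ?addr_ge0 ?norm2_ge0 //.
rewrite sqr_norm2 sqrrD !sqr_norm2 dotDl !dotDr (dotC y x).
have := dot_le_norm2 x y; lra.
Qed.

Lemma norm2_sum_le (I : finType) (F : I -> 'cV[R]_n) (Pr : pred I) :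
  norm2 (\sum_(i | Pr i) F i) <= \sum_(i | Pr i) norm2 (F i).
Proof.
elim/big_ind2: _ => [|x1 x2 y1 y2 h1 h2|//].
  by rewrite /norm2 dot0l sqrtr0.
exact: le_trans (norm2D_le _ _) (lerD h1 h2).
Qed.

End Dot.

Section Projection.
Variables (R : realType) (n : nat).

Definition orthoproj (P : 'M[R]_n) : Prop := P^T = P /\ P *m P = P.

Variable P : 'M[R]_n.
Hypothesis hP : orthoproj P.

Lemma dot_proj x y : dot (P *m x) y = dot x (P *m y).
Proof. by rewrite dot_mulmxl hP.1. Qed.

Lemma dot_projK x y : dot (P *m x) (P *m y) = dot x (P *m y).
Proof. by rewrite dot_proj mulmxA hP.2. Qed.

(** Pythagoras: |x - Px|^2 = |x|^2 - |Px|^2. *)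
Lemma dot_proj_le x : dot (P *m x) (P *m x) <= dot x x.
Proof.
have := dot_ge0 (x - P *m x).
rewrite !dotBl !dotBr dot_projK dot_proj; lra.
Qed.

Lemma orthoprojC : orthoproj (1%:M - P).
Proof.
split; first by rewrite linearB /= trmx1 hP.1.
by rewrite mulmxBl !mulmxBr !mulmx1 mul1mx hP.2 subrr subr0.
Qed.

(** Both sides are <e_i, P e_i>. Hence a zero on the diagonal means a zero column, and the
    elimination may look at the diagonal alone. *)
Lemma dot_col i : dot (col i P) (col i P) = P i i.
Proof.
by rewrite !colE dot_projK -colE dotC dot_delta mxE.
Qed.

Lemma diag_ge0 i : 0 <= P i i.
Proof. by rewrite -dot_col dot_ge0. Qed.

Lemma entry_sym i j : P i j = P j i.
Proof. by rewrite -{1}hP.1 mxE. Qed.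

Lemma col_eq0 i : P i i = 0 -> col i P = 0.
Proof. by rewrite -dot_col => /dot_eq0. Qed.

Section Pivot.
Variable i : 'I_n.
Hypothesis Pi : 0 < P i i.
(** By [dot_col] this is column i scaled to length 1. As a unit vector fixed by P, it can be split
    off with P - b b^T remaining an orthogonal projection. *)
Let b : 'cV[R]_n := (Num.sqrt (P i i))^-1 *: col i P.

Lemma proj_pivot : P *m b = b.
Proof. by rewrite /b -scalemxAr !colE mulmxA hP.2. Qed.

Lemma pivot_norm : b^T *m b = 1%:M.
Proof.
apply/matrixP => j k; rewrite !ord1 -dotE mxE /b dotZl dotZr dot_col mulrA -invfM -expr2.
by rewrite sqr_sqrtr ?ltW // mulVf ?eqxx // gt_eqF.
Qed.

Lemma orthoproj_pivot : orthoproj (P - b *m b^T).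
Proof.
split; first by rewrite linearB /= trmx_mul trmxK hP.1.
rewrite mulmxBl !mulmxBr hP.2 mulmxA proj_pivot -!mulmxA.
rewrite -{2}hP.1 -trmx_mul proj_pivot.
by rewrite (mulmxA b^T) pivot_norm mul1mx subrr subr0.
Qed.

Lemma trace_pivot : \tr (P - b *m b^T) = \tr P - 1.
Proof. by rewrite linearB /= (mxtrace_mulC b) pivot_norm mxtrace1. Qed.

Lemma pivot_diag : (P - b *m b^T) i i = 0.
Proof.
rewrite !mxE big_ord1 !mxE -mulrACA -invfM -expr2 sqr_sqrtr ?ltW //.
by rewrite mulrA mulVf ?gt_eqF // mul1r subrr.
Qed.

(** P_jj = 0 kills column j, so b_j = 0. Zeros on the diagonal thus survive later pivots, and a
    single pass over the diagonal is enough. *)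
Lemma pivot_diag0 j : P j j = 0 -> (P - b *m b^T) j j = 0.
Proof.
move=> Pjj; have /colP /(_ i) := col_eq0 Pjj; rewrite !mxE => Pij.
by rewrite big_ord1 !mxE entry_sym Pij Pjj !mulr0 subr0.
Qed.

End Pivot.
End Projection.

(** * The iterates of the Basic Procedure *)

Section Iterates.
Variables (R : realType) (n : nat) (P : 'M[R]_n) (c : R).
Hypotheses (hP : orthoproj P) (hc : 0 < c < 2) (n0 : (0 < n)%N).

Local Notation thr := (threshold R n).
Local Notation it := (bp_iterate P c).

(** Rewrites the real power in terms of a square root, which the machine can compute. *)
Lemma thresholdE : thr = (2 * (n%:R * Num.sqrt n%:R))^-1.
Proof.
rewrite /threshold (_ : 3 / 2 = 1 + 2^-1 :> R); last by field.
rewrite powRD; last by rewrite pnatr_eq0 -lt0n n0 implybT.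
by rewrite powRr1 // powR12_sqrt.
Qed.

Lemma threshold_gt0 : 0 < thr.
Proof. by rewrite thresholdE invr_gt0 !mulr_gt0 ?sqrtr_gt0 ?ltr0n. Qed.

Lemma bp_alphaE s : bp_alpha P s = (norm2 (bp_p P s))^-1 * dot (bp_p P s) (bp_z s).
Proof. by rewrite /bp_alpha dotZl. Qed.

(** Valid for p_K = 0 as well, where the convention 0^-1 = 0 makes alpha vanish. *)
Lemma bp_alpha_norm s : norm2 (bp_p P s) * bp_alpha P s = dot (bp_p P s) (bp_z s).
Proof.
rewrite bp_alphaE; have [h|h] := eqVneq (norm2 (bp_p P s)) 0.
  by rewrite (norm2_eq0 h) dot0l !mulr0.
by rewrite mulVKf.
Qed.

Lemma bp_eE (s : bp_state R n) i : bp_e s i 0 = (bp_z s i 0 <= 0)%R%:R.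
Proof.
rewrite /bp_e summxE; case: (boolP (bp_z s i 0 <= 0)) => h.
  rewrite (bigD1 i) ?inE //= mxE !eqxx big1 ?addr0 // => j /andP[_ ji].
  by rewrite mxE eq_sym (negPf ji).
rewrite big1 // => j; rewrite inE mxE; case: eqP => // <-.
by rewrite (negPf h).
Qed.

(** All that the estimates use about an update; it already excludes p_K = 0. *)
Definition active s := bp_alpha P s <= - thr.

Lemma active_norm_gt0 s : active s -> 0 < norm2 (bp_p P s).
Proof.
rewrite /active => h; rewrite lt_neqAle norm2_ge0 andbT eq_sym; apply/eqP => p0.
by have := threshold_gt0; move: h; rewrite bp_alphaE p0 invr0 mul0r; lra.
Qed.

Lemma verdict_active s : bp_verdict P s = None -> active s.
Proof. by rewrite /bp_verdict; do 2 case: ifP => // _; case: ifP. Qed.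

Definition running N := forall t, (t < N)%N -> active (it t).

Lemma iterateS t : it t.+1 = bp_step P c (it t). Proof. by []. Qed.

Lemma bp_vE t : bp_v (it t) = bp_y (it t) - bp_z (it t).
Proof. by case: t. Qed.

Lemma bp_zE t : bp_z (it t) = P *m bp_y (it t).
Proof.
elim: t => [//|t IH]; rewrite iterateS /bp_step /= IH.
by rewrite mulmxBr -scalemxAr.
Qed.

(** In an update alpha is negative, so a nonnegative multiple of the indicator of K is added: y
    never drops below its initial value. *)
Lemma bp_y_ge t i : running t -> n%:R^-1 <= bp_y (it t) i 0.
Proof.
elim: t => [|t IH] h; first by rewrite /= mxE.
rewrite iterateS /bp_step /=; have a := h t (leqnn _).
apply: le_trans (IH (fun u ut => h u (ltnW ut))) _.
rewrite 3!mxE bp_eE lerDl oppr_ge0 mulr_le0_ge0 //.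
rewrite pmulr_rle0; last by case/andP: hc.
rewrite pmulr_lle0 ?invr_gt0 ?active_norm_gt0 //.
by apply: le_trans a _; rewrite oppr_le0 ltW // threshold_gt0.
Qed.

(** Expanding the square gives exactly |z|^2 - c (2 - c) alpha^2, and alpha^2 is at least the
    squared threshold. *)
Lemma step_norm s : active s ->
  dot (bp_z (bp_step P c s)) (bp_z (bp_step P c s)) <=
  dot (bp_z s) (bp_z s) - c * (2 - c) * thr ^+ 2.
Proof.
move=> a; have p0 := active_norm_gt0 a.
rewrite /= dotBl !dotBr !(dotZl, dotZr) (dotC (bp_z s) (bp_p P s)).
rewrite -bp_alpha_norm -(sqr_norm2 (bp_p P s)).
rewrite (_ : _ - _ = dot (bp_z s) (bp_z s) - c * (2 - c) * bp_alpha P s ^+ 2); last first.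
  by field; rewrite gt_eqF.
rewrite lerD2l lerN2 ler_wpM2l //.
  by case/andP: hc => c0 c2; rewrite mulr_ge0 ?subr_ge0 ?ltW.
have := threshold_gt0; move: a; rewrite /active; nra.
Qed.

Lemma bp_z0_norm : dot (bp_z (it 0)) (bp_z (it 0)) <= n%:R^-1.
Proof.
rewrite /= (le_trans (dot_proj_le hP _)) //.
rewrite /dot (eq_bigr (fun _ => n%:R^-1 * n%:R^-1)); last by move=> i _; rewrite mxE.
by rewrite sumr_const card_ord -[_ *+ n]mulr_natr mulfVK // pnatr_eq0 -lt0n.
Qed.

Lemma bp_z_norm t : running t ->
  dot (bp_z (it t)) (bp_z (it t)) <= n%:R^-1 - t%:R * (c * (2 - c) * thr ^+ 2).
Proof.
elim: t => [|t IH] h; first by rewrite mul0r subr0 bp_z0_norm.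
have a := h t (leqnn _).
apply: le_trans (step_norm a) _.
have := IH (fun u ut => h u (ltnW ut)); rewrite -natr1; lra.
Qed.

Lemma bp_halts : exists N, (forall t, (t < N)%N -> bp_verdict P (it t) = None) /\
  bp_verdict P (it N) != None.
Proof.
suff [N hN] : exists N, bp_verdict P (it N) != None.
  have [M hM Mmin] := ex_minnP (ex_intro (fun N => bp_verdict P (it N) != None) N hN).
  exists M; split=> // t tM; apply/eqP; apply: contraLR tM => ht.
  by rewrite -leqNgt Mmin.
apply: contrapT => h.
have {}h t : active (it t).
  by apply: verdict_active; apply/eqP; apply: contrapT => /negP ht; apply: h; exists t.
set d := c * (2 - c) * thr ^+ 2.
have d0 : 0 < d.
  by rewrite !mulr_gt0 ?exprn_gt0 ?threshold_gt0 // ?subr_gt0; case/andP: hc.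
(* So many updates would make the bound 1/n - t d on |z|^2 negative. *)
set t := (Num.truncn (n%:R^-1 / d)).+1.
have := le_trans (dot_ge0 _) (@bp_z_norm t (fun u _ => h u)).
rewrite -/d subr_ge0 -ler_pdivlMr // leNgt.
by rewrite truncnS_gt.
Qed.

Lemma bp_iterations_le N w (x : 'cV[R]_n) :
  norm2 x <= 1 -> 0 < w -> (forall i, w * norm2 (col i P) <= dot x (col i P)) ->
  running N -> N%:R <= 2 * n%:R / (c * w).
Proof.
move=> x1 w0 hx hN.
have x_p s : w * norm2 (bp_p P s) <= dot x (bp_p P s).
  have -> : bp_p P s = \sum_(k in [set k : 'I_n | bp_z s k 0 <= 0]) col k P.
    by rewrite /bp_p mulmx_sumr; apply: eq_bigr => k _; rewrite colE.
  rewrite dot_sumr (le_trans (ler_wpM2l (ltW w0) (norm2_sum_le _ _))) //.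
  by rewrite mulr_sumr; apply: ler_sum.
have c0 : 0 < c by case/andP: hc.
have x_z t : running t -> t%:R * (c * w * thr) <= dot x (bp_z (it t)).
  elim: t => [_|t IH h].
    (* The initial z is the average of the columns, each of which has a nonnegative product with
       x. *)
    rewrite mul0r /= (_ : P *m _ = \sum_i n%:R^-1 *: col i P); last first.
      apply/colP => i; rewrite !mxE summxE; apply: eq_bigr => j _; rewrite !mxE mulrC //.
    rewrite dot_sumr sumr_ge0 // => i _; rewrite dotZr mulr_ge0 ?invr_ge0 ?ler0n //.
    by rewrite (le_trans _ (hx i)) // mulr_ge0 ?norm2_ge0 ?ltW.
  have a := h t (leqnn _); have p0 := active_norm_gt0 a.
  rewrite iterateS /= dotBr dotZr -natr1.
  have h1 := IH (fun u ut => h u (ltnW ut)).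
  have h2 : c * (w * thr) <= - (c * (bp_alpha P (it t) / norm2 (bp_p P (it t))) *
      dot x (bp_p P (it t))).
    set al := bp_alpha P _ in a *; set np := norm2 _ in p0 *.
    have hb : thr <= - (al / np) * np by rewrite mulNr mulfVK ?gt_eqF // lerNr.
    have b0 : 0 <= - (al / np).
      by rewrite -(pmulr_lge0 _ p0) (le_trans (ltW threshold_gt0)).
    rewrite -mulNr -mulrN -mulrA ler_pM2l //.
    apply: le_trans (ler_wpM2l b0 (x_p (it t))).
    by rewrite mulrCA ler_pM2l.
  lra.
have zN : norm2 (bp_z (it N)) <= (Num.sqrt n%:R)^-1.
  rewrite -sqrtrV ?ler0n // ler_wsqrtr // (le_trans (bp_z_norm hN)) // gerBl.
  case/andP: hc => _ c2.
  by rewrite !mulr_ge0 ?ler0n ?exprn_ge0 ?subr_ge0 ?ltW // threshold_gt0.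
have {}x_z : N%:R * (c * w * thr) <= (Num.sqrt n%:R)^-1.
  apply: le_trans (x_z N hN) _; apply: le_trans (dot_le_norm2 _ _) _.
  by apply: le_trans zN; rewrite ler_piMl ?norm2_ge0.
have n0' : 0 < n%:R :> R by rewrite ltr0n.
have sn0 : 0 < Num.sqrt n%:R :> R by rewrite sqrtr_gt0.
(* N c w thr <= 1/sqrt n with thr = 1/(2 n sqrt n) yields N <= 2n/(cw). *)
rewrite -ler_pdivlMr ?mulr_gt0 ?threshold_gt0 // in x_z.
rewrite (le_trans x_z) // thresholdE.
by apply: le_of_eq; field; rewrite !gt_eqF.
Qed.

(** The left side is the total negative part of z. Since z lies in the range of P, <e_K, z> = <p_K,
    z> = |p_K| alpha, where |p_K| <= |e_K| <= sqrt n, and sqrt n times the threshold is 1/(2n). *)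
Lemma neg_part_le N : - thr <= bp_alpha P (it N) ->
  - dot (bp_e (it N)) (bp_z (it N)) <= (2 * n%:R)^-1.
Proof.
move=> h.
have n0' : 0 < n%:R :> R by rewrite ltr0n.
have sn0 : 0 < Num.sqrt n%:R :> R by rewrite sqrtr_gt0.
have -> : dot (bp_e (it N)) (bp_z (it N)) = dot (bp_p P (it N)) (bp_z (it N)).
  by rewrite bp_zE /bp_p dot_projK.
have e_n : norm2 (bp_p P (it N)) <= Num.sqrt n%:R.
  rewrite ler_wsqrtr // (le_trans (dot_proj_le hP _)) //.
  have <- : \sum_(i < n) 1 = n%:R :> R by rewrite sumr_const card_ord.
  apply: ler_sum => i _.
  by rewrite bp_eE -natrM lern1; case: (bp_z _ _ _ <= 0).
rewrite -bp_alpha_norm -mulrN.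
apply: le_trans (_ : norm2 (bp_p P (it N)) * thr <= _).
  by rewrite ler_wpM2l ?norm2_ge0 // lerNl.
apply: le_trans (_ : Num.sqrt n%:R * thr <= _).
  by rewrite ler_wpM2r // ltW ?threshold_gt0.
rewrite thresholdE; apply: le_of_eq; field.
by rewrite !gt_eqF.
Qed.

(* A coordinate with v_j <= 0 has z_j >= y_j >= 1/n, while a large alpha
   bounds the total negative part of z by 1/(2n). *)
Lemma bp_case0 N j : running N -> bp_verdict P (it N) = Some 0%N ->
  bp_v (it N) j 0 <= 0 ->
  (P *m bp_y (it N)) j 0 != 0 /\ bound' P (bp_y (it N)) j <= 1 / 2.
Proof.
move=> hN hv vj.
have n0' : 0 < n%:R :> R by rewrite ltr0n.
have /neg_part_le h : - thr <= bp_alpha P (it N).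
  move: hv; rewrite /bp_verdict; do 2 case: ifP => // _; case: ifP => // /negbT.
  by rewrite -ltNge => /ltW.
have zj : n%:R^-1 <= bp_z (it N) j 0.
  apply: le_trans (bp_y_ge j hN) _; move: vj; rewrite bp_vE !mxE; lra.
have zj0 : 0 < bp_z (it N) j 0 by rewrite (lt_le_trans _ zj) // invr_gt0.
rewrite /bound' -bp_zE; split; first by rewrite gt_eqF.
(* As z_j > 0, the positive part of z_i / (-z_j) is -z_i / z_j for i in K and 0 otherwise. *)
rewrite (_ : \sum_i _ = - dot (bp_e (it N)) (bp_z (it N)) / bp_z (it N) j 0); last first.
  rewrite /dot -sumrN mulr_suml; apply: eq_bigr => i _; rewrite bp_eE.
  rewrite invrN mulrN; case: (lerP (bp_z (it N) i 0) 0) => hz.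
    rewrite mul1r mulNr; apply/max_idPr.
    by rewrite oppr_ge0 mulr_le0_ge0 ?invr_ge0 ?(ltW zj0).
  by rewrite mul0r oppr0 mul0r; apply/max_idPl; rewrite oppr_le0 divr_ge0 ?ltW.
rewrite ler_pdivrMr // (le_trans h) // invfM mul1r ler_pM2l ?invr_gt0 //.
Qed.

End Iterates.

(** * The projection of a matrix and its condition number *)

Section ProjP.
Variable R : realType.

(** [xget] falls back to 0 unless a Moore-Penrose inverse exists, so [invmx M] is first exhibited as
    one; the equation M X M = M then leaves no other choice. *)
Lemma mp_inverse_unit n (M : 'M[R]_n) : M \in unitmx -> mp_inverse M = invmx M.
Proof.
move=> uM; rewrite /mp_inverse.
have hex : is_mp_inverse M (invmx M).
  by split; rewrite ?mulmxV ?mulVmx ?mul1mx ?trmx1.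
case: xgetP => [X -> [h _ _ _]|/(_ (invmx M)) /=]; last by move=> /(_ hex).
have := congr1 (fun Y => invmx M *m Y *m invmx M) h.
by rewrite /= mulVmx // mul1mx !mulmxA mulVmx // mul1mx mulmxK.
Qed.

(** If u A A^T = 0 then |uA|^2 = 0, so uA = 0, and full row rank gives u = 0. *)
Lemma gram_unit m n (A : 'M[R]_(m, n)) : \rank A = m -> A *m A^T \in unitmx.
Proof.
move=> rA; rewrite -row_free_unit -kermx_eq0; apply/eqP/row_matrixP => i.
rewrite row0; set u := row i _.
have uA : u *m (A *m A^T) = 0 by apply/sub_kermxP; exact: row_sub.
have : dot (u *m A)^T (u *m A)^T = 0.
  by rewrite dotE trmxK trmx_mul mulmxA -(mulmxA u) uA mul0mx mxE.
move=> /dot_eq0 /(congr1 trmx); rewrite trmxK trmx0 => uA0.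
have rf : row_free A by rewrite /row_free rA.
by apply: (row_free_inj rf); rewrite uA0 mul0mx.
Qed.

Variables (m n : nat) (A : 'M[R]_(m, n)).
Hypothesis rA : \rank A = m.

Lemma projQE : projQ A = A^T *m invmx (A *m A^T) *m A.
Proof. by rewrite /projQ mp_inverse_unit // gram_unit. Qed.

Lemma orthoproj_projP : orthoproj (projP A).
Proof.
have uG := gram_unit rA.
rewrite /projP; apply: orthoprojC; rewrite projQE; split.
  by rewrite !trmx_mul trmxK trmx_inv trmx_mul trmxK mulmxA.
by rewrite -!mulmxA (mulmxA A) (mulmxA (invmx _)) mulVmx // mul1mx.
Qed.

(** Cyclicity turns this into the trace of the m by m identity. It is how m enters the cost of the
    elimination. *)
Lemma trace_projQ : \tr (1%:M - projP A) = m%:R.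
Proof.
have uG := gram_unit rA.
rewrite /projP opprB addrC subrK projQE -mulmxA mxtrace_mulC -mulmxA mulVmx //.
by rewrite mxtrace1.
Qed.

End ProjP.

Lemma rank_real_of_rat (R : realType) m n (A : 'M[rat]_(m, n)) :
  \rank (real_of_rat R A) = \rank A.
Proof. exact: mxrank_map. Qed.

(** * Witnesses for a positive condition number *)

Section ConditionNumber.
Variables (R : realType) (n : nat) (P : 'M[R]_n).

Local Notation colmin x :=
  (inf [set dot x ((norm2 (col i P))^-1 *: col i P) | i in [set: 'I_n]]%classic).

(** [inf] is 0 on sets without an infimum, so positivity rules that default out and supplies the
    lower bound. *)
Lemma colmin_le x i : 0 < colmin x ->
  colmin x <= dot x ((norm2 (col i P))^-1 *: col i P).
Proof.
move=> h; apply: ge_inf; last by exists i.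
set E := (X in has_lbound X).
have [[]//|/inf_out h'] := pselect (has_inf E).
by move: h; rewrite h' ltxx.
Qed.

Lemma cond_number_witness w : 0 < w < cond_number P ->
  exists x : 'cV[R]_n, norm2 x = 1 /\
    forall i, 0 < norm2 (col i P) /\ w * norm2 (col i P) <= dot x (col i P).
Proof.
move=> /andP[w0 wr].
have hs : has_sup [set colmin x | x in [set x : 'cV[R]_n | norm2 x = 1]]%classic.
  apply: contrapT => /sup_out h.
  by move: (lt_trans w0 wr); rewrite /cond_number h ltxx.
have d0 : 0 < cond_number P - w by rewrite subr_gt0.
have [_ [x /= x1 <-]] := sup_adherent d0 hs.
rewrite -/(cond_number P) opprB addrC subrK => wx.
exists x; split=> // i.
have := lt_le_trans wx (colmin_le i (lt_trans w0 wx)); rewrite dotZr.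
(* A zero column contributes 0 to the minimum, which would contradict w > 0. *)
have [h|h] := eqVneq (norm2 (col i P)) 0.
  by rewrite h invr0 mul0r => /(lt_trans w0); rewrite ltxx.
have p0 : 0 < norm2 (col i P) by rewrite lt_neqAle eq_sym h norm2_ge0.
by move=> /ltW; rewrite mulrC ler_pdivlMr.
Qed.

(** Otherwise a witness for the midpoint of 1 and rho would violate Cauchy-Schwarz. The bound
    absorbs the preprocessing cost n^2 m into n^2 m / rho. *)
Lemma cond_number_le1 : (0 < n)%N -> 0 < cond_number P -> cond_number P <= 1.
Proof.
move=> n0 r0; rewrite leNgt; apply/negP => r1.
have w : 0 < (1 + cond_number P) / 2 < cond_number P by apply/andP; lra.
have [x [x1 /(_ (Ordinal n0))]] := cond_number_witness w.
move=> [p0 hp]; have := le_trans hp (dot_le_norm2 _ _).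
by rewrite x1 ler_pM2r //; lra.
Qed.

End ConditionNumber.

(** * The well-conditioned example A = (I, -I) *)

Section Example.
Variables (R : realType) (m : nat).
Hypothesis m0 : (0 < m)%N.
Let A : 'M[R]_(m, m + m) := row_mx 1%:M (- 1%:M).

Lemma example_infeasible : ~ dual_feasible A.
Proof.
move=> [u hu]; have i : 'I_m by exists 0%N.
have /andP[h1 _] := hu (lshift m i); have /andP[h2 _] := hu (rshift m i).
move: h1 h2; rewrite tr_row_mx mul_col_mx col_mxEu col_mxEd.
rewrite linearN /= trmx1 mulNmx mul1mx !mxE; lra.
Qed.

Lemma example_rank : \rank A = m.
Proof.
apply/eqP/row_freeP; exists (col_mx 1%:M 0).
by rewrite mul_row_col mulmx1 mulmx0 addr0.
Qed.

Lemma example_projP :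
  projP A = 2^-1 *: block_mx 1%:M 1%:M 1%:M 1%:M.
Proof.
rewrite /projP projQE ?example_rank //.
rewrite tr_row_mx linearN /= trmx1 mul_row_col mulmx1 mulmxN mulNmx mulmx1 opprK.
rewrite (_ : 1%:M + 1%:M = (2 : R)%:M); last first.
  by rewrite -mulr2n -scaler_nat scale_scalar_mx mulr1.
rewrite invmx_scalar mul_mx_scalar -scalemxAl mul_col_row.
rewrite !(mulmx1, mul1mx, mulNmx, mulmxN) opprK.
rewrite scalar_mx_block scale_block_mx opp_block_mx add_block_mx scale_block_mx.
have half : 1%:M - 2^-1 *: 1%:M = 2^-1 *: 1%:M :> 'M[R]_m.
  by rewrite -[X in X - _]scale1r -scalerBl; congr (_ *: _); field.
by congr block_mx; rewrite // sub0r scalerN opprK.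
Qed.

Let P := projP A.
Let u (x : 'cV[R]_(m + m)) i := dot x ((norm2 (col i P))^-1 *: col i P).

(** Columns k and m+k of P coincide: both are (e_k + e_{m+k})/2, of length 1/sqrt 2. *)
Lemma example_column x k :
  u x (lshift m k) = (Num.sqrt 2)^-1 * (x (lshift m k) 0 + x (rshift m k) 0) /\
  u x (rshift m k) = (Num.sqrt 2)^-1 * (x (lshift m k) 0 + x (rshift m k) 0).
Proof.
have hP : orthoproj P by apply/orthoproj_projP/example_rank.
have s0 : 0 < Num.sqrt 2 :> R by rewrite sqrtr_gt0.
have cnorm i : P i i = 2^-1 -> (norm2 (col i P))^-1 = Num.sqrt 2.
  by rewrite /norm2 dot_col // => ->; rewrite sqrtrV // invrK.
have half (t : R) : Num.sqrt 2 * (2^-1 * t) = (Num.sqrt 2)^-1 * t.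
  rewrite mulrA; congr (_ * _); have h2 := sqr_sqrtr (ler0n R 2).
  by rewrite -[in 2^-1]h2; field; rewrite gt_eqF.
have Pl : P (lshift m k) (lshift m k) = 2^-1.
  by rewrite /P example_projP mxE block_mxEul mxE eqxx mulr1.
have Pr : P (rshift m k) (rshift m k) = 2^-1.
  by rewrite /P example_projP mxE block_mxEdr mxE eqxx mulr1.
have cE i : (forall j, P j i = 2^-1 * ((j == lshift m k)%:R + (j == rshift m k)%:R)) ->
    dot x (col i P) = 2^-1 * (x (lshift m k) 0 + x (rshift m k) 0).
  move=> h.
  have -> : col i P = 2^-1 *: (delta_mx (lshift m k) 0 + delta_mx (rshift m k) 0).
    by apply/colP => j; rewrite mxE h !mxE !andbT.
  by rewrite dotZr dotDr !dot_delta.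
rewrite /u !dotZr !cnorm // !cE // => j; rewrite /P example_projP mxE;
  case: (split_ordP j) => l ->; rewrite ?(block_mxEul, block_mxEur, block_mxEdl, block_mxEdr)
  mxE ?(inj_eq (@lshift_inj _ _)) ?(inj_eq (@rshift_inj _ _))
  ?(eq_lrshift, eq_rlshift) ?(addr0, add0r) //.
Qed.

(** Upper bound: summing over the m pairs of equal columns gives m w <= <x, 1>/sqrt 2 <= sqrt n /
    sqrt 2, where m = n/2. The constant unit vector attains it, as its product with every normalized
    column is the same. *)
Lemma example_cond : cond_number P = Num.sqrt 2 / Num.sqrt (m + m)%:R.
Proof.
set n := (m + m)%N; set v := _ / _.
have n0 : 0 < n%:R :> R by rewrite ltr0n addn_gt0 m0.
have s0 : 0 < Num.sqrt 2 :> R by rewrite sqrtr_gt0.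
have sn0 : 0 < Num.sqrt n%:R :> R by rewrite sqrtr_gt0.
have s2 := sqr_sqrtr (ler0n R 2); have sn := sqr_sqrtr (ltW n0).
have v0 : 0 < v by rewrite divr_gt0.
have ub : (ubound [set inf [set u x i | i in [set: 'I_n]]
                  | x in [set x | norm2 x = 1]] v)%classic.
  move=> _ [x /= x1 <-].
  (* [colmin_le] needs a positive infimum; the other case is trivial since v > 0. *)
  have [/le_trans->//|i0] := lerP (inf [set u x i | i in [set: 'I_n]]%classic) 0.
    exact: ltW.
  set w := inf _ in i0 *.
  have wk k : w <= (Num.sqrt 2)^-1 * (x (lshift m k) 0 + x (rshift m k) 0).
    by rewrite -(example_column x k).1; apply: colmin_le.
  have : \sum_(k < m) w <= (Num.sqrt 2)^-1 * dot x (const_mx 1).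
    rewrite /dot big_split_ord /= -big_split /= mulr_sumr; apply: ler_sum => k _.
    by rewrite !mxE !mulr1.
  have : dot x (const_mx 1) <= Num.sqrt n%:R.
    rewrite (le_trans (dot_le_norm2 _ _)) // x1 mul1r ler_wsqrtr // /dot.
    by rewrite (eq_bigr (fun _ => 1)) ?sumr_const ?card_ord // => i _; rewrite !mxE mulr1.
  rewrite -(ler_pM2l (_ : 0 < (Num.sqrt 2)^-1)) ?invr_gt0 // => h1 h2.
  have {h1 h2} := le_trans h2 h1; rewrite sumr_const card_ord -[w *+ _]mulr_natr.
  rewrite (_ : m%:R = n%:R / 2); last by rewrite /n natrD; field.
  rewrite -ler_pdivlMr ?divr_gt0 // => h; apply: le_trans h _.
  apply: le_of_eq.
  by rewrite /v -[X in _ / (X / _)]sn -[X in _ / (_ / X)]s2; field; rewrite !gt_eqF.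
have hv : ([set inf [set u x i | i in [set: 'I_n]]
           | x in [set x | norm2 x = 1]] v)%classic.
  exists (const_mx (Num.sqrt n%:R)^-1).
    rewrite /= /norm2 /dot (eq_bigr (fun _ => n%:R^-1)); last first.
      by move=> i _; rewrite mxE -invfM -expr2 sn.
    by rewrite sumr_const card_ord -[_^-1 *+ _]mulr_natr mulVf ?gt_eqF // sqrtr1.
  rewrite (_ : image _ _ = [set v]%classic) ?inf1 //.
  have s22 : (Num.sqrt 2)^-1 * 2 = Num.sqrt 2 :> R.
    by rewrite -[X in _ * X]s2 expr2 mulKf ?gt_eqF.
  have uv i : u (const_mx (Num.sqrt n%:R)^-1) i = v.
    case: (split_ordP i) => k ->;
      rewrite ?(example_column _ k).1 ?(example_column _ k).2 !mxE;
      by rewrite -mulr2n -[_^-1 *+ 2]mulr_natl mulrA s22.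
  apply/seteqP; split=> [_ [i _ <-] //|_ ->].
  by exists (Ordinal (ltn_addr m m0)).
apply/le_anti/andP; split.
  by apply: ge_sup => //; exists v.
by apply: ub_le_sup => //; exists v.
Qed.

End Example.

(** * The program *)

Definition reg_i : nat := 3.
Definition reg_j : nat := 4.
Definition reg_k : nat := 5.
Definition reg_rank : nat := 6.
Definition reg_notpos : nat := 7.
Definition reg_neg : nat := 8.
(** [arr_S] is the residual of I - P, row k of [arr_B] the k-th vector b, [arr_E] the argument and
    [arr_p] the value of a product with P; row 0 of [arr_w] holds scalars. *)
Definition arr_S : nat := 6.
Definition arr_B : nat := 7.
Definition arr_E : nat := 8.
Definition arr_p : nat := 9.
Definition arr_w : nat := 10.


(** Equality of indices is expressed by two negated strict comparisons, the only test on indices. *)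
Definition init_residual : cmd :=
  for_loop reg_i reg_n (for_loop reg_j reg_n
    (If (BAnd (BNot (BNlt (NReg reg_i) (NReg reg_j)))
              (BNot (BNlt (NReg reg_j) (NReg reg_i))))
       (RAssign arr_S (NReg reg_i) (NReg reg_j)
          (RSub (RNat (NConst 1)) (RArr arr_P (NReg reg_i) (NReg reg_j))))
       (RAssign arr_S (NReg reg_i) (NReg reg_j)
          (RSub (RNat (NConst 0)) (RArr arr_P (NReg reg_i) (NReg reg_j)))))).

Definition pivot : cmd :=
  Seq (for_loop reg_j reg_n
         (RAssign arr_B (NReg reg_rank) (NReg reg_j)
            (RMul (RDiv (RNat (NConst 1)) (RSqrt (RArr arr_S (NReg reg_i) (NReg reg_i))))
                  (RArr arr_S (NReg reg_j) (NReg reg_i)))))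
  (Seq (for_loop reg_j reg_n (for_loop reg_k reg_n
         (RAssign arr_S (NReg reg_j) (NReg reg_k)
            (RSub (RArr arr_S (NReg reg_j) (NReg reg_k))
                  (RMul (RArr arr_B (NReg reg_rank) (NReg reg_j))
                        (RArr arr_B (NReg reg_rank) (NReg reg_k)))))))
       (NAssign reg_rank (NSucc (NReg reg_rank)))).

(** The residual remains a projection, whose diagonal is nonnegative, so [<= 0] tests for a zero
    pivot. *)
Definition factor : cmd :=
  Seq (NAssign reg_rank (NConst 0))
      (for_loop reg_i reg_n
         (If (BRle (RArr arr_S (NReg reg_i) (NReg reg_i)) (RNat (NConst 0))) Skip pivot)).

Definition dot_cmd a1 (i1 : nexp) a2 (i2 : nexp) (slot : nat) : cmd :=
  Seq (RAssign arr_w (NConst 0) (NConst slot) (RNat (NConst 0)))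
      (for_loop reg_i reg_n
         (RAssign arr_w (NConst 0) (NConst slot)
            (RAdd (RArr arr_w (NConst 0) (NConst slot))
                  (RMul (RArr a1 i1 (NReg reg_i)) (RArr a2 i2 (NReg reg_i)))))).

(** Multiplies by P in the form I - sum_k b_k b_k^T: two passes of length n for each of the m
    vectors. *)
Definition project : cmd :=
  Seq (for_loop reg_i reg_n (RAssign arr_p (NConst 0) (NReg reg_i)
         (RArr arr_E (NConst 0) (NReg reg_i))))
      (for_loop reg_k reg_rank
         (Seq (dot_cmd arr_B (NReg reg_k) arr_E (NConst 0) 0)
              (for_loop reg_i reg_n
                 (RAssign arr_p (NConst 0) (NReg reg_i)
                    (RSub (RArr arr_p (NConst 0) (NReg reg_i))
                          (RMul (RArr arr_w (NConst 0) (NConst 0))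
                                (RArr arr_B (NReg reg_k) (NReg reg_i)))))))).

(** [arr_E] serves here as the argument 1/n of the first projection. *)
Definition init_iterate : cmd :=
  Seq (NAssign reg_N (NConst 0))
  (Seq (for_loop reg_i reg_n (RAssign arr_E (NConst 0) (NReg reg_i)
          (RDiv (RNat (NConst 1)) (RNat (NReg reg_n)))))
  (Seq project
  (Seq (for_loop reg_i reg_n (RAssign arr_Y (NConst 0) (NReg reg_i)
          (RArr arr_E (NConst 0) (NReg reg_i))))
  (Seq (for_loop reg_i reg_n (RAssign arr_Z (NConst 0) (NReg reg_i)
          (RArr arr_p (NConst 0) (NReg reg_i))))
       (for_loop reg_i reg_n (RAssign arr_V (NConst 0) (NReg reg_i)
          (RSub (RArr arr_Y (NConst 0) (NReg reg_i))
                (RArr arr_Z (NConst 0) (NReg reg_i))))))))).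

Definition v_nonpos : bexp :=
  BRle (RArr arr_V (NReg reg_N) (NReg reg_i)) (RNat (NConst 0)).
Definition z_nonpos : bexp :=
  BRle (RArr arr_Z (NReg reg_N) (NReg reg_i)) (RNat (NConst 0)).
Definition z_nonneg : bexp :=
  BRle (RNat (NConst 0)) (RArr arr_Z (NReg reg_N) (NReg reg_i)).

Definition mark a (b : bexp) : cmd :=
  for_loop reg_i reg_n
    (If b (RAssign a (NConst 0) (NReg reg_i) (RNat (NConst 1)))
          (RAssign a (NConst 0) (NReg reg_i) (RNat (NConst 0)))).

Definition flag x (b : bexp) : cmd :=
  Seq (NAssign x (NConst 0))
      (for_loop reg_i reg_n (If b (NAssign x (NConst 1)) Skip)).

(** Slot 0 is the scratch cell of [project]. *)
Definition slot_norm : nat := 1.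
Definition slot_alpha : nat := 2.
Definition slot_step : nat := 3.
Definition scalar_cell (slot : nat) : rexp := RArr arr_w (NConst 0) (NConst slot).
Definition set_scalar (slot : nat) : rexp -> cmd :=
  RAssign arr_w (NConst 0) (NConst slot).

Definition direction : cmd :=
  Seq (mark arr_E z_nonpos)
  (Seq project
  (Seq (dot_cmd arr_p (NConst 0) arr_p (NConst 0) slot_norm)
  (Seq (dot_cmd arr_p (NConst 0) arr_Z (NReg reg_N) slot_alpha)
  (Seq (set_scalar slot_norm (RSqrt (scalar_cell slot_norm)))
       (set_scalar slot_alpha (RDiv (scalar_cell slot_alpha) (scalar_cell slot_norm))))))).

(* Case 3 encodes "perform a further update". *)
Definition set_case : cmd :=
  If (BNlt (NConst 0) (NReg reg_notpos))
    (If (BNlt (NConst 0) (NReg reg_neg))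
      (If (BRle (scalar_cell slot_alpha)
             (RSub (RNat (NConst 0)) (RDiv (RNat (NConst 1))
               (RMul (RNat (NConst 2))
                  (RMul (RNat (NReg reg_n)) (RSqrt (RNat (NReg reg_n))))))))
         (NAssign reg_case (NConst 3))
         (NAssign reg_case (NConst 0)))
      (NAssign reg_case (NConst 1)))
    (NAssign reg_case (NConst 2)).

(** J is chosen as the set where v_j <= 0: it is nonempty once the first test fails, and in case 0
    all its members satisfy the required bound. The direction is left in memory for [update]. *)
Definition verdict : cmd :=
  Seq (flag reg_notpos v_nonpos)
  (Seq (flag reg_neg (BNot z_nonneg))
  (Seq (mark arr_J v_nonpos)
  (Seq direction set_case))).

Definition update : cmd :=
  Seq (set_scalar slot_step
         (RMul (RArr arr_c (NConst 0) (NConst 0))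
               (RDiv (scalar_cell slot_alpha) (scalar_cell slot_norm))))
  (Seq (for_loop reg_i reg_n (RAssign arr_Y (NSucc (NReg reg_N)) (NReg reg_i)
          (RSub (RArr arr_Y (NReg reg_N) (NReg reg_i))
                (RMul (scalar_cell slot_step) (RArr arr_E (NConst 0) (NReg reg_i))))))
  (Seq (for_loop reg_i reg_n (RAssign arr_Z (NSucc (NReg reg_N)) (NReg reg_i)
          (RSub (RArr arr_Z (NReg reg_N) (NReg reg_i))
                (RMul (scalar_cell slot_step) (RArr arr_p (NConst 0) (NReg reg_i))))))
  (Seq (for_loop reg_i reg_n (RAssign arr_V (NSucc (NReg reg_N)) (NReg reg_i)
          (RSub (RArr arr_Y (NSucc (NReg reg_N)) (NReg reg_i))
                (RArr arr_Z (NSucc (NReg reg_N)) (NReg reg_i)))))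
       (NAssign reg_N (NSucc (NReg reg_N)))))).

Definition basic_procedure : cmd :=
  Seq init_residual (Seq factor (Seq init_iterate (Seq verdict
    (While (BNlt (NConst 2) (NReg reg_case)) (Seq update verdict))))).

(** * Specifications of the linear algebra routines *)

Section Specs.
Variable R : realType.
Implicit Types s : store R.

Lemma run_init_residual s : let n := reg s reg_n in
  run init_residual s (fun s' T =>
    (forall i j, (i < n)%N -> (j < n)%N ->
       arr s' arr_S i j = (i == j)%:R - arr s arr_P i j) /\
    (T <= n * (n * 100 + 13) + 6)%N).
Proof.
move=> n; apply: run_conseq.
  (* 93 is a generous allowance for the body; with the loop overhead 7 it makes 100 per round. The
     same figure recurs below. *)
  apply: (run_map2 (f := fun i j => (i == j)%:R - arr s arr_P i j) (K := 93)) => //.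
  move=> i j s1 ni nj F1 hi hj _.
  apply: run_if; rewrite /= hi hj -!leqNgt -eqn_leq eq_sym.
  have P1 k l : arr s1 arr_P k l = arr s arr_P k l by rewrite F1.2.
  by case: ifP => _; apply: run_rassign; rewrite /= hi hj P1.
by move=> s' T _ [h hT]; split=> //; rewrite -addnA in hT.
Qed.

Lemma run_dot (a1 : nat) i1 (a2 : nat) i2 slot s :
  ncost i1 = 1%N -> ncost i2 = 1%N -> a1 != arr_w -> a2 != arr_w ->
  (forall s1, framed (dot_cmd a1 i1 a2 i2 slot) s s1 ->
     neval s1 i1 = neval s i1 /\ neval s1 i2 = neval s i2) ->
  run (dot_cmd a1 i1 a2 i2 slot) s (fun s' T =>
    [/\ arr s' arr_w 0 slot =
         \sum_(k < reg s reg_n) arr s a1 (neval s i1) k * arr s a2 (neval s i2) k,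
        forall i j : nat, (i != 0%N) || (j != slot) -> arr s' arr_w i j = arr s arr_w i j
      & (T <= reg s reg_n * 100 + 20)%N]).
Proof.
move=> c1 c2 a1w a2w hi; apply/run_seq/run_rassign.
set s0 := set_arr _ _ _ _ _.
have F0 : framed (dot_cmd a1 i1 a2 i2 slot) s s0.
  split=> // a i j; rewrite /= inE negb_or => /andP[/negPf aw _].
  by rewrite aw.
apply: run_conseq.
  apply: (run_sum (a := arr_w) (i := 0) (j := slot) (K := 93)
    (f := fun k => arr s a1 (neval s i1) k * arr s a2 (neval s i2) k)) => //.
  move=> k s1 kn F1 xk hs1; apply: run_rassign => /=.
  have F01 : framed (dot_cmd a1 i1 a2 i2 slot) s s1.
    apply: framed_trans F0 _; apply: framed_sub F1 => z //=; rewrite !inE.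
      by move=> ->; rewrite ?orbT.
  have [e1 e2] := hi _ F01; rewrite e1 e2.
  rewrite xk (F01.2 a1) ?inE ?negb_or ?a1w // (F01.2 a2) ?inE ?negb_or ?a2w //.
  by rewrite c1 c2.
move=> s' T _ [h1 h2 hT]; split.
- by rewrite h1 /= !eqxx add0r.
- by move=> i j hij; rewrite h2 //= -[_ && _]negbK negb_and hij.
- by move: hT => /=; lia.
Qed.

Lemma run_project s : let n := reg s reg_n in
  run project s (fun s' T =>
    (forall i, (i < n)%N -> arr s' arr_p 0 i = arr s arr_E 0 i -
       \sum_(k < reg s reg_rank) (\sum_(j < n) arr s arr_B k j * arr s arr_E 0 j)
                                * arr s arr_B k i) /\
    (T <= 50 + n * 100 + reg s reg_rank * (n * 200 + 50))%N).
Proof.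
move=> n; apply: run_seq; apply: run_conseq.
  apply: (run_map (a := arr_p) (i := 0) (f := fun k => arr s arr_E 0 k) (K := 93)) => //.
  move=> k s1 kn F1 xk _; apply: run_rassign; rewrite /= xk F1.2 //.
move=> s1 T1 F1 [h1 hT1]; apply: run_conseq.
  apply: (run_for (I := fun l s' => forall i, (i < n)%N -> arr s' arr_p 0 i =
    arr s arr_E 0 i - \sum_(k < l) (\sum_(j < n) arr s arr_B k j * arr s arr_E 0 j)
                                * arr s arr_B k i) (K := (n * 200 + 43)%N)) => //.
    by move=> i ni; rewrite /= h1 ni big_ord0 subr0.
  move=> k s2 kr F2 xk hI.
  have n2 : reg s2 reg_n = n by rewrite F2.1 // F1.1.
  have B2 i j : arr s2 arr_B i j = arr s arr_B i j by rewrite F2.2 // F1.2.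
  have E2 i j : arr s2 arr_E i j = arr s arr_E i j by rewrite F2.2 // F1.2.
  apply: run_seq; apply: run_conseq.
    apply: run_dot => // s3 F3; split=> //=; exact: F3.1.
  move=> s3 T3 F3 [h3 _ hT3]; apply: run_conseq.
    apply: (run_map (a := arr_p) (i := 0) (K := 93) (f := fun j => arr s2 arr_p 0 j -
      arr s3 arr_w 0 0 * arr s arr_B k j)) => //.
    move=> j s4 jn F4 xj h4; apply: run_rassign; rewrite /= xj h4 ltnn andbF.
    have k4 : reg s4 reg_k = k by rewrite F4.1 // F3.1.
    have B4 : arr s4 arr_B k j = arr s arr_B k j by rewrite F4.2 // F3.2.
    have w4 : arr s4 arr_w 0 0 = arr s3 arr_w 0 0 by rewrite F4.2.
    by rewrite k4 B4 w4 F3.2.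
  move=> s4 T4 F4 [h4 hT4].
  split; last first.
    by move: hT3 hT4; rewrite F3.1 // n2; lia.
  move=> i ni /=; rewrite h4 F3.1 // n2 ni /= hI // big_ord_recr /= opprD addrA.
  congr (_ - _ * _); rewrite h3 n2 /= xk.
  by apply: eq_bigr => j _; rewrite B2 E2.
move=> s2 T2 F2 [h2 hT2]; move: h2 hT1 hT2; rewrite F1.1 // -/n => h2 hT1 hT2.
split=> //.
lia.
Qed.

(** The scaled pivot column is saved in [arr_B] first, so the residual can then be overwritten in
    place. *)
Lemma run_pivot s : let n := reg s reg_n in let i := reg s reg_i in
  let r := reg s reg_rank in
  let b j := 1 / Num.sqrt (arr s arr_S i i) * arr s arr_S j i in
  run pivot s (fun s' T =>
    [/\ reg s' reg_rank = r.+1,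
        forall k j, (j < n)%N ->
          arr s' arr_B k j = if k == r then b j else arr s arr_B k j,
        forall j k, (j < n)%N -> (k < n)%N ->
          arr s' arr_S j k = arr s arr_S j k - b j * b k
      & (T <= n * (n * 100 + 113) + 20)%N]).
Proof.
move=> n i r b; apply: run_seq; apply: run_conseq.
  apply: (run_map (a := arr_B) (i := r) (f := b) (K := 93)) => // k s1 kn F1 xk _.
  apply: run_rassign; rewrite /= xk.
  have -> : reg s1 reg_rank = r by rewrite F1.1.
  have -> : reg s1 reg_i = i by rewrite F1.1.
  have S1 j l : arr s1 arr_S j l = arr s arr_S j l by rewrite F1.2.
  by rewrite !S1.
move=> s1 T1 F1 [h1 hT1].
have n1 : reg s1 reg_n = n by rewrite F1.1.
apply: run_seq; apply: run_conseq.
  apply: (run_map2 (a := arr_S) (f := fun j k => arr s arr_S j k - b j * b k) (K := 93)) => //.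
  rewrite n1 => j k s2 jn kn F2 hj hk S2; apply: run_rassign; rewrite /= hj hk S2.
  have -> : reg s2 reg_rank = r by rewrite F2.1 // F1.1.
  have B2 l : (l < n)%N -> arr s2 arr_B r l = b l.
    by move=> ln; rewrite F2.2 // h1 eqxx ln.
  by rewrite !B2 // F1.2.
move=> s2 T2 F2 [h2 hT2]; apply: run_nassign; rewrite n1 in h2 hT2.
split=> /=.
- by rewrite F2.1 // F1.1.
- by move=> k j jn; rewrite F2.2 // h1 jn andbT.
- exact: h2.
- by move: hT1 hT2; rewrite -/n; lia.
Qed.

Definition factor_row n s k : 'cV[R]_n := \col_(j < n) arr s arr_B k j.

Lemma run_factor n m (M : 'M[R]_n) s :
  orthoproj M -> \tr M = m%:R -> reg s reg_n = n ->
  (forall i j : 'I_n, arr s arr_S i j = M i j) ->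
  run factor s (fun s' T =>
    [/\ (reg s' reg_rank <= m)%N,
        M = \sum_(k < reg s' reg_rank) factor_row n s' k *m (factor_row n s' k)^T
      & (T <= n * 20 + m * (n * (n * 100 + 113) + 20) + 10)%N]).
Proof.
move=> hM trM sn hS; apply/run_seq/run_nassign.
set s0 := set_reg _ _ _; set C := (n * (n * 100 + 113) + 20)%N.
(* [M'] is the current residual. The trace equation counts pivots, the first [k] diagonal entries
   are cleared, and the time charges 20 per visit and [C] per pivot. *)
pose I k s' T := exists M' : 'M[R]_n,
  [/\ orthoproj M', forall i j : 'I_n, arr s' arr_S i j = M' i j,
      \tr M' + (reg s' reg_rank)%:R = m%:R,
      M = M' + \sum_(k < reg s' reg_rank) factor_row n s' k *m (factor_row n s' k)^T &
      (forall j : 'I_n, (j < k)%N -> M' j j = 0) /\ (T <= 8 + k * 20 + reg s' reg_rank * C)%N].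
apply: run_conseq.
  apply: (run_for_time (I := I)) => //.
    exists M; split=> //.
    - by rewrite /= addr0.
    - by rewrite /= big_ord0 addr0.
  move=> k s1 T1; rewrite /= sn => kn F1 xk [M' [hM' hS1 tr1 M1 [d1 hT1]]].
  pose ko := Ordinal kn.
  have Skk : arr s1 arr_S k k = M' ko ko by rewrite -hS1.
  apply: run_if; rewrite /= xk Skk; case: lerP => Mkk.
    apply: run_skip; exists M'; split=> //=; split=> [j|]; last by move: hT1; lia.
    rewrite ltnS leq_eqVlt => /orP[/eqP jk|]; last exact: d1.
    have -> : j = ko by apply: val_inj.
    by apply: le_anti; rewrite Mkk diag_ge0.
  have n1 : reg s1 reg_n = n by rewrite F1.1.
  apply: run_conseq (run_pivot s1) _ => s2 T2 F2 /=; rewrite n1 xk => -[r2 B2 S2 hT2].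
  set b : 'cV[R]_n := (Num.sqrt (M' ko ko))^-1 *: col ko M'.
  have bE (j : 'I_n) : 1 / Num.sqrt (arr s1 arr_S k k) * arr s1 arr_S j k = b j 0.
    by rewrite Skk div1r !mxE -(hS1 j ko).
  have rowE (l : nat) : factor_row n (set_reg s2 reg_i k.+1) l =
      if l == reg s1 reg_rank then b else factor_row n s1 l.
    apply/colP => j; rewrite mxE /= B2 //; case: eqP => _; rewrite ?bE //.
    by rewrite mxE.
  exists (M' - b *m b^T); split=> /=.
  - exact: orthoproj_pivot.
  - by move=> i j; rewrite S2 // !bE hS1 !mxE big_ord1 !mxE.
  - by rewrite trace_pivot // r2 -natr1 -tr1; ring.
  - rewrite r2 big_ord_recr /= M1 -addrA; congr (_ + _).
    rewrite rowE eqxx addrCA addNr addr0; apply: eq_bigr => l _.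
    by rewrite rowE ltn_eqF.
  - split; last by rewrite r2; move: hT1 hT2; rewrite -/C; lia.
    move=> j; rewrite ltnS leq_eqVlt => /orP[/eqP jk|jk].
      have -> : j = ko by apply: val_inj.
      exact: pivot_diag.
    by apply: pivot_diag0 => //; apply: d1.
move=> s' T F [M' [hM' _ tr' eM [d' hT]]]; rewrite /= sn in d' hT.
(* The whole diagonal is zero, hence so is every column; the trace equation then makes the number of
   pivots exactly m. *)
have M0 : M' = 0.
  apply/matrixP => i j; rewrite mxE.
  by have /colP /(_ i) := col_eq0 hM' (d' j (ltn_ord j)); rewrite !mxE.
move: tr' eM; rewrite M0 mxtrace0 !add0r => /eqP; rewrite eqr_nat => /eqP rm eM.
split; rewrite ?rm //; first by rewrite rm in eM.
by move: hT; rewrite rm -/C /=; lia.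
Qed.

Definition row_is n s (a t : nat) (x : 'cV[R]_n) : Prop :=
  forall i : 'I_n, arr s a t i = x i 0.

(** Depends only on [reg_n], [reg_rank] and [arr_B], which stay fixed after the elimination, so it
    persists by framing. *)
Definition factored n (P : 'M[R]_n) s : Prop :=
  reg s reg_n = n /\
  forall x, P *m x = x - \sum_(k < reg s reg_rank)
                           dot (factor_row n s k) x *: factor_row n s k.

Lemma factored_framed n (P : 'M[R]_n) p s s' :
  reg_n \notin mod_regs p -> reg_rank \notin mod_regs p -> arr_B \notin mod_arrs p ->
  framed p s s' -> factored P s -> factored P s'.
Proof.
move=> hn hr hB F [sn hP]; split; first by rewrite F.1.
move=> x; rewrite hP F.1 //; congr (_ - _); apply: eq_bigr => k _.
suff -> : factor_row n s' k = factor_row n s k by [].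
by apply/colP => j; rewrite !mxE F.2.
Qed.

Lemma run_project_vec n (P : 'M[R]_n) x s :
  factored P s -> row_is s arr_E 0 x ->
  run project s (fun s' T =>
    row_is s' arr_p 0 (P *m x) /\
    (T <= 50 + n * 100 + reg s reg_rank * (n * 200 + 50))%N).
Proof.
move=> [sn hP] hE; apply: run_conseq (run_project s) _ => s' T _ /=.
rewrite sn => -[h hT]; split=> // i; rewrite h // hP hE !mxE summxE.
congr (_ - _); apply: eq_bigr => k _; rewrite !mxE; congr (_ * _).
by apply: eq_bigr => j _; rewrite hE mxE.
Qed.

(** The loop rules take functions on [nat], whereas vectors are indexed by ordinals. *)
Lemma ord_extend n T (f : 'I_n -> T) (d : T) :
  {g : nat -> T | forall i : 'I_n, g i = f i}.
Proof. by exists (fun k => oapp f d (insub k)) => i; rewrite valK. Qed.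

Lemma run_mark n s a b (f : 'I_n -> bool) : reg s reg_n = n -> (bcost b <= 20)%N ->
  (forall (i : 'I_n) s1, framed (mark a b) s s1 -> reg s1 reg_i = i -> beval s1 b = f i) ->
  run (mark a b) s (fun s' T =>
    (forall i : 'I_n, arr s' a 0 i = (f i)%:R) /\ (T <= n * 100 + 6)%N).
Proof.
move=> sn cb hb; have [g gf] := ord_extend f false; apply: run_conseq.
  apply: (run_map (a := a) (i := 0) (K := 93) (f := fun k => (g k)%:R)) => //.
  rewrite sn => k s1 kn F1 xk _; apply: run_if.
  rewrite (hb (Ordinal kn)) // -gf /=.
  by case: (g _); apply: run_rassign; rewrite /= xk; split=> //; lia.
by move=> s' T _; rewrite sn => -[h hT]; split=> // i; rewrite h eqxx ltn_ord /= gf.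
Qed.

Lemma run_flag_cmd n s x b (f : 'I_n -> bool) : reg s reg_n = n ->
  x != reg_n -> x != reg_i -> (bcost b <= 20)%N ->
  (forall (i : 'I_n) s1, framed (flag x b) s s1 -> reg s1 reg_i = i ->
     beval s1 b = ~~ f i) ->
  run (flag x b) s (fun s' T =>
    (0 < reg s' x)%N = ~~ [forall i, f i] /\ (T <= n * 100 + 10)%N).
Proof.
move=> sn xn xi cb hb; have [g gf] := ord_extend f false.
have nx : (reg_n == x) = false by rewrite eq_sym (negPf xn).
apply/run_seq/run_nassign; apply: run_conseq.
  apply: (run_flag (f := fun k => ~~ g k)) => //.
  - by rewrite eq_sym.
  - by rewrite /= eqxx.
  rewrite /= nx sn => k s1 kn F1 xk.
  rewrite -[k]/(nat_of_ord (Ordinal kn)) gf; apply: hb => //.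
  split=> [y|a i j _]; last by rewrite F1.2.
  rewrite /= inE negb_or => /andP[yx hy]; rewrite F1.1 //.
  by rewrite /= (negPf yx).
move=> s' T _; rewrite /= nx sn => -[h hT]; split; last first.
  by have := leq_mul (leqnn n) cb; move: hT; lia.
by rewrite lt0n h; congr (~~ _); apply: eq_forallb => i; rewrite negbK gf.
Qed.

End Specs.

(** * Specifications of the verdict, the update and the initial iterate *)

Section Verdict.
Variables (R : realType) (n : nat) (P : 'M[R]_n) (c : R).
Implicit Types (s : store R) (sg : bp_state R n).

Definition represents s t sg : Prop :=
  [/\ row_is s arr_Y t (bp_y sg), row_is s arr_Z t (bp_z sg)
    & row_is s arr_V t (bp_v sg)].

Definition directed s sg : Prop :=
  [/\ row_is s arr_E 0 (bp_e sg), row_is s arr_p 0 (bp_p P sg),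
      arr s arr_w 0 slot_norm = norm2 (bp_p P sg)
    & arr s arr_w 0 slot_alpha = bp_alpha P sg].

Definition project_time n r := (50 + n * 100 + r * (n * 200 + 50))%N.

Lemma run_direction sg s : factored P s -> row_is s arr_Z (reg s reg_N) (bp_z sg) ->
  run direction s (fun s' T => directed s' sg /\
    (T <= project_time n (reg s reg_rank) + n * 300 + 100)%N).
Proof.
move=> fP hZ; have [sn _] := fP.
apply: run_seq; apply: run_conseq.
  apply: (run_mark (f := fun i => bp_z sg i 0 <= 0)) => // i s1 F1 xi.
  by rewrite /= xi F1.1 // F1.2 // hZ.
move=> s1 T1 F1 [h1 hT1].
have fP1 : factored P s1 by apply: factored_framed F1 fP.
have E1 : row_is s1 arr_E 0 (bp_e sg) by move=> i; rewrite h1 bp_eE.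
apply: run_seq; apply: run_conseq (run_project_vec fP1 E1) _ => s2 T2 F2 [h2 hT2].
have n2 : reg s2 reg_n = n by rewrite F2.1 // F1.1.
apply: run_seq; apply: run_conseq.
  by apply: run_dot.
move=> s3 T3 F3 [h3 _ hT3].
apply: run_seq; apply: run_conseq.
  apply: run_dot => // s4 F4; split=> //=; exact: F4.1.
move=> s4 T4 F4 [h4 k4 hT4].
have p3 i : arr s3 arr_p 0 i = arr s2 arr_p 0 i by rewrite F3.2.
have Z3 j i : arr s3 arr_Z j i = arr s arr_Z j i by rewrite F3.2 // F2.2 // F1.2.
have N3 : reg s3 reg_N = reg s reg_N by rewrite F3.1 // F2.1 // F1.1.
have n3 : reg s3 reg_n = n by rewrite F3.1.
have e3 : arr s4 arr_w 0 slot_norm = dot (bp_p P sg) (bp_p P sg).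
  rewrite k4 // h3 n2 /=; apply: eq_bigr => i _; by rewrite h2.
have e4 : arr s4 arr_w 0 slot_alpha = dot (bp_p P sg) (bp_z sg).
  rewrite h4 n3 /= N3; apply: eq_bigr => i _; by rewrite p3 h2 Z3 hZ.
apply/run_seq/run_rassign/run_rassign; split.
  split=> [i|i||] /=.
  - by rewrite F4.2 // F3.2 // F2.2 // E1.
  - by rewrite F4.2 // p3 h2.
  - by rewrite e3.
  - by rewrite e3 e4 bp_alphaE mulrC.
move: hT1 hT2 hT3 hT4; rewrite n2 n3 /= F1.1 // /project_time; lia.
Qed.

Definition case_code (o : option nat) : nat := if o is Some k then k else 3.

Lemma run_verdict sg s : (0 < n)%N -> factored P s -> represents s (reg s reg_N) sg ->
  run verdict s (fun s' T =>
    [/\ directed s' sg, reg s' reg_case = case_code (bp_verdict P sg),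
        forall j : 'I_n, arr s' arr_J 0 j = (bp_v sg j 0 <= 0)%R%:R
      & (T <= project_time n (reg s reg_rank) + n * 600 + 200)%N]).
Proof.
move=> n0 fP [hY hZ hV]; have [sn _] := fP.
apply: run_seq; apply: run_conseq.
  apply: (run_flag_cmd (f := fun i => 0 < bp_v sg i 0)) => // i s1 F1 xi.
  by rewrite /= xi F1.1 // F1.2 // hV leNgt.
move=> s1 T1 F1 [h1 hT1].
have n1 : reg s1 reg_n = n by rewrite F1.1.
apply: run_seq; apply: run_conseq.
  apply: (run_flag_cmd (f := fun i => 0 <= bp_z sg i 0)) => // i s2 F2 xi.
  by rewrite /= xi F2.1 // F2.2 // F1.1 // F1.2 // hZ.
move=> s2 T2 F2 [h2 hT2].
have n2 : reg s2 reg_n = n by rewrite F2.1.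
apply: run_seq; apply: run_conseq.
  apply: (run_mark (f := fun i => bp_v sg i 0 <= 0)) => // i s3 F3 xi.
  by rewrite /= xi F3.1 // F3.2 // F2.1 // F2.2 // F1.1 // F1.2 // hV.
move=> s3 T3 F3 [h3 hT3].
have fP3 : factored P s3.
  do 3 (apply: factored_framed; try eassumption; try exact: isT).
have Z3 : row_is s3 arr_Z (reg s3 reg_N) (bp_z sg).
  by move=> i; rewrite F3.1 // F3.2 // F2.1 // F2.2 // F1.1 // F1.2 // hZ.
apply: run_seq; apply: run_conseq (run_direction fP3 Z3) _ => s4 T4 F4 [h4 hT4].
have [E4 p4 e4 a4] := h4.
have {}hT : (T1 + (T2 + (T3 + T4)) <= project_time n (reg s reg_rank) + n * 600 + 130)%N.
  move: hT1 hT2 hT3 hT4; rewrite F3.1 // F2.1 // F1.1 //; lia.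
have n4 : reg s4 reg_n = n by rewrite F4.1 // F3.1.
have v4 : (0 < reg s4 reg_notpos)%N = ~~ [forall i, 0 < bp_v sg i 0].
  by rewrite F4.1 // F3.1 // F2.1.
have z4 : (0 < reg s4 reg_neg)%N = ~~ [forall i, 0 <= bp_z sg i 0].
  by rewrite F4.1 // F3.1.
have J4 (j : 'I_n) : arr s4 arr_J 0 j = (bp_v sg j 0 <= 0)%R%:R.
  by rewrite F4.2.
rewrite /set_case /bp_verdict; apply: run_if; rewrite /= v4 if_neg.
case: ifP => _.
  by apply: run_nassign; split=> //=; lia.
apply: run_if; rewrite /= z4 if_neg; case: ifP => _.
  by apply: run_nassign; split=> //=; lia.
apply: run_if; rewrite /= a4 n4 sub0r div1r -thresholdE //; case: ifP => _.
  by apply: run_nassign; split=> //=; lia.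
by apply: run_nassign; split=> //=; lia.
Qed.

(** Preservation of the earlier rows matters because the output must contain every iterate. *)
Lemma run_update sg s : let t := reg s reg_N in
  reg s reg_n = n -> arr s arr_c 0 0 = c ->
  represents s t sg -> directed s sg ->
  run update s (fun s' T =>
    [/\ reg s' reg_N = t.+1, represents s' t.+1 (bp_step P c sg),
        forall a u (i : 'I_n), a \in [:: arr_Y; arr_Z; arr_V] -> (u <= t)%N ->
          arr s' a u i = arr s a u i
      & (T <= n * 300 + 100)%N]).
Proof.
move=> t sn sc [hY hZ hV] [hE hp hnorm halpha].
apply/run_seq/run_rassign; set s0 := set_arr _ _ _ _ _.
have w0 : arr s0 arr_w 0 slot_step = c * (bp_alpha P sg / norm2 (bp_p P sg)).
  by rewrite /s0 /= sc halpha hnorm.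
set a := c * _ in w0.
apply: run_seq; apply: run_conseq.
  apply: (run_map (a := arr_Y) (i := t.+1) (K := 93)
    (f := fun j => arr s arr_Y t j - a * arr s arr_E 0 j)) => // k s1 kn F1 xk hs1.
  apply: run_rassign; rewrite /= xk.
  have -> : reg s1 reg_N = t by rewrite F1.1.
  by rewrite hs1 ltnn andbF !F1.2 // w0.
move=> s1 T1 F1 [h1 hT1].
apply: run_seq; apply: run_conseq.
  apply: (run_map (a := arr_Z) (i := t.+1) (K := 93)
    (f := fun j => arr s arr_Z t j - a * arr s arr_p 0 j)) => // k s2 kn F2 xk hs2.
  apply: run_rassign; rewrite /= xk.
  have -> : reg s2 reg_N = t by rewrite F2.1 // F1.1.
  by rewrite hs2 ltnn andbF !F2.2 // !F1.2 // w0.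
move=> s2 T2 F2 [h2 hT2].
apply: run_seq; apply: run_conseq.
  apply: (run_map (a := arr_V) (i := t.+1) (K := 93)
    (f := fun j => arr s2 arr_Y t.+1 j - arr s2 arr_Z t.+1 j)) => // k s3 kn F3 xk hs3.
  apply: run_rassign; rewrite /= xk.
  have -> : reg s3 reg_N = t by rewrite F3.1 // F2.1 // F1.1.
  by rewrite !F3.2.
move=> s3 T3 F3 [h3 hT3].
have n0' : reg s0 reg_n = n by [].
have n1 : reg s1 reg_n = n by rewrite F1.1.
have n2 : reg s2 reg_n = n by rewrite F2.1.
have N3 : reg s3 reg_N = t by rewrite F3.1 // F2.1 // F1.1.
rewrite n0' in h1 hT1; rewrite n1 in h2 hT2; rewrite n2 in h3 hT3.
have Y3 u i : arr s3 arr_Y u i = arr s1 arr_Y u i by rewrite F3.2 // F2.2.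
have Z3 u i : arr s3 arr_Z u i = arr s2 arr_Z u i by rewrite F3.2.
apply: run_nassign; split=> /=.
- by rewrite N3.
- have Yt (i : 'I_n) : arr s3 arr_Y t.+1 i = bp_y (bp_step P c sg) i 0.
    by rewrite Y3 h1 eqxx ltn_ord /= !mxE hY hE.
  have Zt (i : 'I_n) : arr s3 arr_Z t.+1 i = bp_z (bp_step P c sg) i 0.
    by rewrite Z3 h2 eqxx ltn_ord /= 3!mxE hZ hp.
  split=> i /=; [exact: Yt|exact: Zt|].
  have Y2 : arr s2 arr_Y t.+1 i = arr s3 arr_Y t.+1 i by rewrite F3.2.
  by rewrite h3 eqxx ltn_ord /= Y2 -Z3 Yt Zt /= !mxE.
- move=> a' u i ha ut; have ut' : (u == t.+1) = false by lia.
  move: ha; rewrite !inE => /or3P[] /eqP ->.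
  + by rewrite Y3 h1 ut'.
  + by rewrite Z3 h2 ut' F1.2.
  + by rewrite h3 ut' /= F2.2 // F1.2.
- lia.
Qed.

Lemma run_init_iterate s : factored P s ->
  run init_iterate s (fun s' T =>
    [/\ reg s' reg_N = 0%N, represents s' 0 (bp_init P)
      & (T <= project_time n (reg s reg_rank) + n * 400 + 100)%N]).
Proof.
move=> fP; have [sn _] := fP.
apply/run_seq/run_nassign; set s0 := set_reg _ _ _.
have fP0 : factored P s0 by [].
have sn0 : reg s0 reg_n = n by [].
apply: run_seq; apply: run_conseq.
  apply: (run_map (a := arr_E) (i := 0) (K := 93) (f := fun _ => n%:R^-1)) => //.
  move=> k s1 kn F1 xk hs1; apply: run_rassign; rewrite /= xk.
  by rewrite F1.1 // sn0 div1r.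
move=> s1 T1 F1 [h1 hT1].
have fP1 : factored P s1 by apply: factored_framed F1 fP0.
have n1 := fP1.1.
have E1 : row_is s1 arr_E 0 (const_mx n%:R^-1 : 'cV[R]_n).
  by move=> i; rewrite h1 sn0 ltn_ord /= mxE.
apply: run_seq; apply: run_conseq (run_project_vec fP1 E1) _ => s2 T2 F2 [h2 hT2].
have n2 : reg s2 reg_n = n by rewrite F2.1.
apply: run_seq; apply: run_conseq.
  apply: (run_map (a := arr_Y) (i := 0) (K := 93) (f := fun k => arr s2 arr_E 0 k)) => //.
  by move=> k s3 kn F3 xk hs3; apply: run_rassign; rewrite /= xk F3.2.
move=> s3 T3 F3 [h3 hT3].
have n3 : reg s3 reg_n = n by rewrite F3.1.
apply: run_seq; apply: run_conseq.
  apply: (run_map (a := arr_Z) (i := 0) (K := 93) (f := fun k => arr s3 arr_p 0 k)) => //.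
  by move=> k s4 kn F4 xk hs4; apply: run_rassign; rewrite /= xk F4.2.
move=> s4 T4 F4 [h4 hT4].
have n4 : reg s4 reg_n = n by rewrite F4.1.
apply: run_conseq.
  apply: (run_map (a := arr_V) (i := 0) (K := 93)
    (f := fun k => arr s4 arr_Y 0 k - arr s4 arr_Z 0 k)) => //.
  by move=> k s5 kn F5 xk hs5; apply: run_rassign; rewrite /= xk !F5.2.
move=> s5 T5 F5 [h5 hT5].
rewrite sn0 in hT1; rewrite n2 in h3 hT3; rewrite n3 in h4 hT4; rewrite n4 in h5 hT5.
have Yt (i : 'I_n) : arr s4 arr_Y 0 i = bp_y (bp_init P) i 0.
  by rewrite F4.2 // h3 ltn_ord F2.2 // E1.
have Zt (i : 'I_n) : arr s4 arr_Z 0 i = bp_z (bp_init P) i 0.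
  by rewrite h4 ltn_ord F3.2 // h2.
split.
- by rewrite F5.1 // F4.1 // F3.1 // F2.1 // F1.1.
- split=> i; [by rewrite F5.2 // Yt|by rewrite F5.2 // Zt|].
  by rewrite h5 ltn_ord /= Yt Zt /= !mxE.
- by move: hT2; rewrite F1.1 //= /project_time; lia.
Qed.

End Verdict.

(** * Correctness and running time *)

Section Correctness.
Variables (R : realType) (n m : nat) (P : 'M[R]_n) (c : R).
Hypotheses (hP : orthoproj P) (hc : 0 < c < 2) (n0 : (0 < n)%N).
Hypothesis trQ : \tr (1%:M - P) = m%:R.
Implicit Types s : store R.

Local Notation it := (bp_iterate P c).

Lemma case_code_gt2 sg : (2 < case_code (bp_verdict P sg))%N = (bp_verdict P sg == None).
Proof. by rewrite /bp_verdict; do 3 case: ifP => // _. Qed.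

(** Invariant at the test of the main loop. The rank [r] is a parameter so that all rounds share one
    time bound. *)
Definition ready r t s : Prop :=
  [/\ reg s reg_N = t, factored P s /\ reg s reg_rank = r, arr s arr_c 0 0 = c,
      forall u, (u <= t)%N -> represents s u (it u) &
      [/\ directed P s (it t), reg s reg_case = case_code (bp_verdict P (it t))
        & forall j : 'I_n, arr s arr_J 0 j = (bp_v (it t) j 0 <= 0)%R%:R]].

Lemma ready_verdict r t s :
  reg s reg_N = t -> factored P s -> reg s reg_rank = r -> arr s arr_c 0 0 = c ->
  (forall u, (u <= t)%N -> represents s u (it u)) ->
  run verdict s (fun s' T => ready r t s' /\ (T <= project_time n r + n * 600 + 200)%N).
Proof.
move=> sN fP sr sc hrep.
have hr : represents s (reg s reg_N) (it t) by rewrite sN; apply: hrep.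
apply: run_conseq (run_verdict n0 fP hr) _ => s' T F [h1 h2 h3 h4].
split; last by rewrite -sr.
split=> //.
- by rewrite F.1.
- split; [by apply: factored_framed F fP|by rewrite F.1].
- by rewrite F.2.
- by move=> u /hrep [hY hZ hV]; split=> i; rewrite F.2.
Qed.

Definition round_time r := (project_time n r + n * 900 + 310)%N.

Lemma run_main_loop r N t s :
  (forall u, (u < N)%N -> bp_verdict P (it u) = None) -> bp_verdict P (it N) != None ->
  (t <= N)%N -> ready r t s ->
  run (While (BNlt (NConst 2) (NReg reg_case)) (Seq update verdict)) s
    (fun s' T => ready r N s' /\ (T <= (N - t) * round_time r + 10)%N).
Proof.
move=> hlt hN; move dE: (N - t)%N => d.
elim: d t s dE => [|d IH] t s dE tN hs.
  have {tN dE} tN : t = N by lia.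
  rewrite tN in hs; have [_ _ _ _ [_ hcase _]] := hs.
  exists s, 4%N; split; last by split.
  by apply: exec_while_false; rewrite /= hcase case_code_gt2 (negPf hN).
have [sN [fP sr] sc hrep [hd hcase _]] := hs.
have tN' : (t < N)%N by lia.
have hrt : represents s (reg s reg_N) (it t) by rewrite sN; apply: hrep.
have [s1 [T1 [e1 [h1 Q1]]]] :
  run (Seq update verdict) s (fun s' T => ready r t.+1 s' /\
    (T <= project_time n r + n * 900 + 300)%N).
  apply: run_seq; apply: run_conseq (run_update fP.1 sc hrt hd) _.
  rewrite sN => s1 T1 F1 [N1 rep1 old1 hT1].
  apply: run_conseq.
    apply: (@ready_verdict r t.+1) => //.
    - by apply: factored_framed F1 fP.
    - by rewrite F1.1.
    - by rewrite F1.2.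
    move=> u; rewrite leq_eqVlt => /orP[/eqP -> //|ut].
    have [hY hZ hV] := hrep u ut.
    by split=> i; rewrite old1 //.
  by move=> s2 T2 _ [h2 hT2]; split=> //; lia.
have [s2 [T2 [e2 [h2 Q2]]]] := IH t.+1 s1 (ltac:(lia)) tN' h1.
exists s2, (bcost (BNlt (NConst 2) (NReg reg_case)) + T1 + T2).+1; split.
  apply: exec_while_true e1 e2.
  by rewrite /= hcase case_code_gt2 hlt.
split=> //=; move: Q1 Q2; rewrite /round_time mulSn; lia.
Qed.

Lemma bp_input_P (i j : 'I_n) : arr (bp_input P c) arr_P i j = P i j.
Proof. by rewrite /= !valK. Qed.

Lemma run_basic_procedure N :
  (forall u, (u < N)%N -> bp_verdict P (it u) = None) -> bp_verdict P (it N) != None ->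
  (0 < m)%N ->
  run basic_procedure (bp_input P c) (fun s T =>
    (exists r, ready r N s) /\ (T <= 5000 * (n * n * m + N * n * m))%N).
Proof.
move=> hlt hN m0; set s0 := bp_input P c.
have n0E : reg s0 reg_n = n by [].
apply: run_seq; apply: run_conseq (run_init_residual s0) _ => s1 T1 F1 [h1 hT1].
rewrite n0E in h1 hT1.
have S1 (i j : 'I_n) : arr s1 arr_S i j = (1%:M - P) i j.
  by rewrite h1 // bp_input_P !mxE.
have n1 : reg s1 reg_n = n by rewrite F1.1.
apply: run_seq; apply: run_conseq (run_factor (orthoprojC hP) trQ n1 S1) _.
move=> s2 T2 F2 [r2 Q2 hT2].
have fP2 : factored P s2.
  split=> [|x]; first by rewrite F2.1.
  rewrite -{1}[P](subKr 1%:M) mulmxBl mul1mx Q2 mulmx_suml; congr (_ - _).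
  apply: eq_bigr => k _; rewrite -mulmxA.
  by apply/colP => i; rewrite mxE big_ord1 -dotE [RHS]mxE mulrC.
apply: run_seq; apply: run_conseq (run_init_iterate fP2) _ => s3 T3 F3 [N3 rep3 hT3].
set r := reg s2 reg_rank in r2 hT3.
have fP3 : factored P s3 by apply: factored_framed F3 fP2.
have r3 : reg s3 reg_rank = r by rewrite F3.1.
have c3 : arr s3 arr_c 0 0 = c by rewrite F3.2 // F2.2 // F1.2.
apply: run_seq; apply: run_conseq.
  apply: (@ready_verdict r 0) => // u; rewrite leqn0 => /eqP -> //.
move=> s4 T4 F4 [h4 hT4].
apply: run_conseq (run_main_loop hlt hN (leq0n N) h4) _ => s5 T5 F5 [h5 hT5].
split; first by exists r.
(* The rank bound r <= m turns nr into nm. *)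
have pt : (project_time n r <= 400 * (n * m))%N.
  rewrite /project_time; have := leq_mul r2 (leqnn (n * 200 + 50)); nia.
have h6 : (round_time r <= 1610 * (n * m))%N by rewrite /round_time; nia.
have h7 : (N * round_time r <= 1610 * (N * n * m))%N.
  by have := leq_mul (leqnn N) h6; lia.
(* As n and m are positive, all lower-order terms are absorbed by n^2 m. *)
have nm1 : (0 < n * m)%N by rewrite muln_gt0 n0.
have nm2 : (n <= n * m)%N by rewrite leq_pmulr.
have nnm : (n * m <= n * n * m)%N by rewrite leq_mul2r leq_pmull ?orbT.
have nn : (n * n <= n * n * m)%N by rewrite leq_pmulr.
have mm : (m <= n * m)%N by rewrite leq_pmull.
rewrite subn0 in hT5.
lia.
Qed.

Lemma ready_output r N s :
  (forall u, (u < N)%N -> bp_verdict P (it u) = None) -> bp_verdict P (it N) != None ->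
  ready r N s -> bp_output P c s.
Proof.
move=> hlt hN [sN _ _ hrep [_ hcase hJ]].
have hrun : running P c N by move=> t /hlt; apply: verdict_active.
split; last first.
  by move=> t i; rewrite sN => /hrep [hY hZ hV]; split.
rewrite sN hcase; case hv: (bp_verdict P (it N)) hN => [k|] // _; split=> //= k0.
rewrite {}k0 in hv.
have inJ j : (j \in [set j : 'I_n | arr s arr_J 0 j != 0]) = (bp_v (it N) j 0 <= 0).
  by rewrite inE hJ pnatr_eq0 eqb0 negbK.
split; last by move=> j; rewrite inJ => hj; apply: bp_case0.
move: hv; rewrite /bp_verdict; case: ifP => // /negbT.
rewrite negb_forall => /existsP[j hj] _.
by apply/set0Pn; exists j; rewrite inJ leNgt.
Qed.

End Correctness.

Section Complexity.
Variable R : realType.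

Section Instance.
Variables (m n : nat) (A : 'M[rat]_(m, n)) (c : R).
Hypotheses (hc : 0 < c < 2) (m0 : (0 < m)%N) (rA : \rank A = m).
Let P := projP (real_of_rat R A).

Lemma cols_gt0 : (0 < n)%N.
Proof. by rewrite (leq_trans m0) // -rA rank_leq_col. Qed.

Lemma basic_procedure_run : exists N s T,
  [/\ exec basic_procedure (bp_input P c) s T, bp_output P c s,
      running P c N & (T <= 5000 * (n * n * m + N * n * m))%N].
Proof.
have rA' : \rank (real_of_rat R A) = m by rewrite rank_real_of_rat.
have hP : orthoproj P by exact: orthoproj_projP.
have [N [hlt hN]] := bp_halts hP hc cols_gt0.
have [s [T [he [[r hr] hT]]]] := run_basic_procedure hP hc cols_gt0 (trace_projQ rA') hlt hN m0.
exists N, s, T; split=> //; last by move=> t /hlt; apply: verdict_active.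
exact: (ready_output hP hc cols_gt0 hlt hN hr).
Qed.

Lemma basic_procedure_time T : bp_time basic_procedure c A T ->
  0 < cond_number P ->
  T%:R <= 5000 * (1 + 4 / c) * (n%:R ^+ 2 * m%:R / cond_number P).
Proof.
move=> [s hs] r0.
have rA' : \rank (real_of_rat R A) = m by rewrite rank_real_of_rat.
have hP : orthoproj P by exact: orthoproj_projP.
have [N [s' [T' [hs' _ hN hT]]]] := basic_procedure_run.
have [_ <-] := exec_det hs' hs.
have c0 : 0 < c by case/andP: hc.
set rho := cond_number P in r0 *.
have wr : 0 < rho / 2 < rho by apply/andP; lra.
have [x [x1 hx]] := cond_number_witness wr.
have r1 := cond_number_le1 cols_gt0 r0.
have w0 : 0 < rho / 2 by case/andP: wr.
have x1' : norm2 x <= 1 by rewrite x1.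
have hNr := bp_iterations_le hP hc cols_gt0 x1' w0 (fun i => (hx i).2) hN.
apply: le_trans (_ : (5000 * (n * n * m + N * n * m))%:R <= _); first by rewrite ler_nat.
rewrite natrM natrD !natrM.
rewrite -[leRHS]mulrA ler_pM2l // mulrDl mul1r lerD //.
  (* Preprocessing: n^2 m <= n^2 m / rho. *)
  by rewrite -expr2 ler_pdivlMr // ler_piMr // mulr_ge0 ?exprn_ge0 ?ler0n.
rewrite -mulrA.
(* Iterations: for w = rho/2 the bound 2n/(cw) on their number is 4n/(c rho). *)
apply: le_trans (ler_wpM2r _ hNr) _; first by rewrite mulr_ge0 ?ler0n.
by apply: le_of_eq; field; rewrite !gt_eqF.
Qed.

End Instance.
End Complexity.

Theorem lemma8 (R : realType) :
  exists prog : cmd,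
    implements_bp R prog /\
    forall c : R, 0 < c < 2 ->
    exists C : R, 0 < C /\
    [/\ (forall (m n : nat) (A : 'M[rat]_(m, n)) (T : nat),
           (0 < m)%N -> \rank A = m ->
           ~ dual_feasible (real_of_rat R A) ->
           bp_time prog c A T ->
           let rho := cond_number (projP (real_of_rat R A)) in
           0 < rho ->
           T%:R <= C * (n%:R ^+ 2 * m%:R / rho)),
        (forall (m n : nat) (A : 'M[rat]_(m, n)) (T : nat) (kappa : R),
           (0 < m)%N -> \rank A = m ->
           ~ dual_feasible (real_of_rat R A) ->
           bp_time prog c A T ->
           0 < kappa ->
           cond_number (projP (real_of_rat R A)) = kappa / Num.sqrt n%:R ->
           T%:R <= C / kappa * (n%:R `^ (5 / 2) * m%:R))
      & (forall (m T : nat), (0 < m)%N ->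
           let n := (m + m)%N in
           let A : 'M[rat]_(m, n) := row_mx 1%:M (- 1%:M) in
           [/\ ~ dual_feasible (real_of_rat R A),
               cond_number (projP (real_of_rat R A))
                 = Num.sqrt 2 / Num.sqrt n%:R
             & bp_time prog c A T ->
               T%:R <= C * (n%:R `^ (5 / 2) * m%:R)])].
Proof.
exists basic_procedure; split.
  move=> c m n A hc m0 rA /=.
  by have [N [s [T [h1 h2 _ _]]]] := basic_procedure_run hc m0 rA; exists s, T.
move=> c hc; exists (5000 * (1 + 4 / c)).
have c0 : 0 < c by case/andP: hc.
have C0 : 0 < 5000 * (1 + 4 / c) by rewrite mulr_gt0 // addr_gt0 // divr_gt0.
set C := 5000 * _ in C0 *.
have kappa_bound m n (A : 'M[rat]_(m, n)) (T : nat) (kappa : R) :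
    (0 < m)%N -> \rank A = m -> bp_time basic_procedure c A T -> 0 < kappa ->
    cond_number (projP (real_of_rat R A)) = kappa / Num.sqrt n%:R ->
    T%:R <= C / kappa * (n%:R `^ (5 / 2) * m%:R).
  move=> m0 rA hT k0 hk.
  have n0 : 0 < n%:R :> R by rewrite ltr0n (cols_gt0 m0 rA).
  have s0 : 0 < Num.sqrt n%:R :> R by rewrite sqrtr_gt0.
  apply: le_trans (basic_procedure_time hc m0 rA hT _) _; rewrite hk ?divr_gt0 //.
  have -> : n%:R `^ (5 / 2) = n%:R ^+ 2 * Num.sqrt n%:R :> R.
    rewrite (_ : 5 / 2 = 2 + 2^-1); last by field.
    rewrite powRD; last by rewrite (gt_eqF n0) implybT.
    by rewrite powR12_sqrt ?ltW // powR_mulrn ?ltW.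
  by apply: le_of_eq; rewrite -/C; field; rewrite !gt_eqF.
split=> //; split.
- move=> m n A T m0 rA _ hT rho r0; exact: basic_procedure_time.
- by move=> m n A T kappa m0 rA _; apply: kappa_bound.
move=> m T m0 n A.
have AE : real_of_rat R A = row_mx 1%:M (- 1%:M).
  by rewrite /real_of_rat /A map_row_mx map_mxN map_mx1.
have cond : cond_number (projP (real_of_rat R A)) = Num.sqrt 2 / Num.sqrt n%:R.
  by rewrite AE example_cond.
split=> //; first by rewrite AE; exact: example_infeasible.
move=> hT.
have rA : \rank A = m by rewrite -(rank_real_of_rat R) AE example_rank.
apply: le_trans (kappa_bound _ _ A T (Num.sqrt 2) m0 rA hT _ cond) _.
  by rewrite sqrtr_gt0.
rewrite ler_wpM2r ?mulr_ge0 ?powR_ge0 ?ler0n //.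
(* Here kappa = sqrt 2 > 1, so C / kappa <= C. *)
rewrite ler_pdivrMr ?sqrtr_gt0 // ler_peMr ?ltW //.
by rewrite -[ltLHS]sqrtr1 ltr_sqrt ?ltr1n.
Qed.
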